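(* Let $\Omega\subset\mathbb{R}^d$ be a bounded domain with $\partial\Omega\in C^\infty$, let $b\in C^\infty(\mathbb{R}^d;\mathbb{R}^d)$, let $X_t$ solve $dX_t=b(X_t)\,dt+\sqrt{2h}\,dB_t$, and let $\tau_X=\inf\{t\ge0:X_t\in\partial\Omega\}$. Let $\nu$ be the outward unit normal to $\partial\Omega$ and let $x_0\in\partial\Omega$ satisfy $\langle b(x_0),\nu(x_0)\rangle<0$. Let $\lambda$ be independent of $h$ and satisfy, for $0<h<h_0$, $$\begin{cases}0<\lambda<\lambda_1(-L),\quad\lambda\ne\langle b(x_0),\nu(x_0)\rangle^2/4,& d\ge2,\\ 0<\lambda<\min\left(\lambda_1(-L),\langle b(x_0),\nu(x_0)\rangle^2/4\right),& d=1.\end{cases}$$ Then there exists $\gamma>0$ such that for all $N\ge1$ and all $x(h)\in\mathbb{R}^d$ for which there are constants $c_1,c_2>0$ with $$\gamma h>|x(h)|>c_1h^N,\qquad\left\langle\frac{x(h)}{|x(h)|},\nu(x_0)\right\rangle<-c_2<0,\qquad x_0+x(h)\in\Omega,\qquad\text{for }0<h<h_0,$$ there exists $C>0$ such that for $h$ small enough $$h\log\mathbb{E}_{x_0+x(h)}e^{\lambda\tau_X/h}\ge Ch\log h^{-1}.$$ Moreover, if $\partial\Omega$ and $b$ are real analytic near $x_0$, there is a $\delta>0$ such that, for $h$ small enough, $$h\log\mathbb{E}_{x_0+x(h)}e^{\lambda\tau_X/h}\ge\delta,$$ and such that for every $\alpha>1$ and $\epsilon>0$ there exist $c_\alpha>0$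 (depending only on $\alpha$) and a function $s(h)>\delta-h^{1-\epsilon}$ with, for $h$ small enough, $$\min\left(c_\alpha e^{-\alpha(s(h)-\delta)/h},1\right)\le P\left(\tau_X\ge\frac{s(h)}{\lambda}\right)\le P\left(\tau_X\ge\frac{\delta-h^{1-\epsilon}}{\lambda}\right),$$ where the probabilities are for the process started at $X_0=x_0+x(h)$.
   Context: $B_t$ is standard Brownian motion in $\mathbb{R}^d$; $\mathbb{E}_y$ denotes expectation for the process started at $X_0=y$. $L=-(hD)^2+i\langle b,hD\rangle$ with $D_j=\frac1i\partial_j$, i.e. $-L=(hD)^2+i\langle-b,hD\rangle=-h^2\Delta-h\langle b,\partial\rangle$, and $\lambda_1(-L)$ denotes the principal eigenvalue of $-L$ in $\Omega$ with Dirichlet boundary conditions (it depends on $h$). *)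

(* Defs.v *)
From HB Require Import structures.
From mathcomp Require Import all_boot all_order all_algebra complex.
From mathcomp Require Import all_classical all_reals all_analysis.

Set Implicit Arguments.
Unset Strict Implicit.
Unset Printing Implicit Defensive.

Import Order.TTheory GRing.Theory Num.Theory.
Import numFieldNormedType.Exports.

Local Open Scope classical_set_scope.
Local Open Scope ring_scope.

(* The norm of ['rV[R]_d] in the library is the sup norm: it defines the right
   topology, but lengths and unit normals need the Euclidean norm below.      *)
Section Euclidean.
Variables (R : realType) (d : nat).
Implicit Types (u v : 'rV[R]_d) (A : set 'rV[R]_d).

Definition dot u v : R := \sum_(i < d) u 0 i * v 0 i.

Definition enorm u : R := Num.sqrt (dot u u).

Definition boundary A : set 'rV[R]_d := closure A `\` A°.

Definition bounded_domain A : Prop :=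
  [/\ open A, connected A, A !=set0 & bounded_set A].

End Euclidean.

Section Regularity.
Variables (R : realType) (d : nat).
Implicit Types (f : 'rV[R]_d -> R) (U : set 'rV[R]_d) (p : 'rV[R]_d).

Definition partial f (i : 'I_d) : 'rV[R]_d -> R :=
  fun x => 'D_(delta_mx 0 i) f x.

Definition partials (s : seq 'I_d) f : 'rV[R]_d -> R :=
  foldr (fun i g => partial g i) f s.

Definition grad f p : 'rV[R]_d := \row_i partial f i p.

(* Meant for open [U] only: no one-sided derivatives. *)
Definition Ck_on U (k : nat) f : Prop :=
  forall s : seq 'I_d, (size s <= k)%N -> forall x, U x ->
    {for x, continuous (partials s f)} /\
    ((size s < k)%N -> forall i, derivable (partials s f) x (delta_mx 0 i)).

Definition smooth_on U f : Prop := forall k, Ck_on U k f.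

(* [f] is the sum of an absolutely convergent power series
   [\sum_al a_al (x - p)^al] on a ball around [p]; the multi-indices [al] are
   exhausted by the cubes [{0, ..., n-1}^d].                                  *)
Definition analytic_at f p : Prop :=
  exists a : {ffun 'I_d -> nat} -> R, exists2 r : R, 0 < r &
    forall x, `|x - p| < r ->
      let term n (al : {ffun 'I_d -> 'I_n}) : R :=
        a [ffun i => al i : nat] * \prod_(i < d) (x 0 i - p 0 i) ^+ al i in
      cvgn (fun n => \sum_(al : {ffun 'I_d -> 'I_n}) `|term n al| : R) /\
      (fun n => \sum_(al : {ffun 'I_d -> 'I_n}) term n al : R) @ \oo --> f x.

Definition smooth_map (b : 'rV[R]_d -> 'rV[R]_d) : Prop :=
  forall i, smooth_on setT (fun x => b x 0 i).

Definition analytic_map_near (b : 'rV[R]_d -> 'rV[R]_d) p : Prop :=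
  \forall q \near p, forall i, analytic_at (fun x => b x 0 i) q.

End Regularity.

Section SmoothBoundary.
Variables (R : realType) (d : nat).
Implicit Types (A : set 'rV[R]_d) (p : 'rV[R]_d).

Definition local_defining_function A p (rho : 'rV[R]_d -> R) : Prop :=
  [/\ exists2 U, open_nbhs p U & smooth_on U rho,
      rho p = 0, grad rho p != 0 & \forall x \near p, A x <-> rho x < 0].

Definition smooth_boundary A : Prop :=
  forall p, boundary A p -> exists rho, local_defining_function A p rho.

(* Independent of the choice of [rho], whose gradient at [p] points out of
   [A = {rho < 0}].                                                           *)
Definition outward_unit_normal A p (n : 'rV[R]_d) : Prop :=
  exists2 rho, local_defining_function A p rho &
    n = (enorm (grad rho p))^-1 *: grad rho p.

Definition analytic_boundary_near A p : Prop :=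
  exists2 rho, local_defining_function A p rho &
    \forall q \near p, analytic_at rho q.

End SmoothBoundary.

Section PrincipalEigenvalue.
Variables (R : realType) (d : nat).
Variables (h : R) (b : 'rV[R]_d -> 'rV[R]_d) (A : set 'rV[R]_d).

(* With D_j = (1/i) d_j, the operator -L = (hD)^2 + i <-b, hD> is
   -h^2 Laplacian - h <b, d>; it has real coefficients.                       *)
Definition opmL (f : 'rV[R]_d -> R) : 'rV[R]_d -> R := fun x =>
  - h ^+ 2 * (\sum_(i < d) partials [:: i; i] f x)
  - h * (\sum_(i < d) b x 0 i * partial f i x).

Definition dirichlet_eigenvalue (mu : R[i]) : Prop :=
  exists u v : 'rV[R]_d -> R,
    [/\ exists x, A x /\ (u x +i* v x)%C <> 0,
        Ck_on A 2 u /\ Ck_on A 2 v,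
        {within closure A, continuous u} /\ {within closure A, continuous v},
        (forall x, boundary A x -> (u x +i* v x)%C = 0) &
        forall x, A x -> (opmL u x +i* opmL v x)%C = mu * (u x +i* v x)%C].

(* The principal eigenvalue is the real eigenvalue lying to the left, in the
   complex plane, of every other eigenvalue of this non-self-adjoint problem. *)
Definition principal_eigenvalue (l : R) : Prop :=
  dirichlet_eigenvalue (l%:C)%C /\
  forall mu : R[i], dirichlet_eigenvalue mu -> l <= complex.Re mu.

End PrincipalEigenvalue.

Section Processes.
Variables (R : realType) (d : nat).
Variables (disp : measure_display) (T : measurableType disp).
Variable P : probability T R.

Definition mutually_independent (I : finType) (Y : I -> T -> R) : Prop :=
  forall A : I -> set R, (forall i, measurable (A i)) ->
    P [set w | forall i, A i (Y i w)] = (\prod_(i : I) P (Y i @^-1` A i))%E.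

(* Index set of time: the nonnegative reals; values at negative times are
   irrelevant. Independence is required jointly over disjoint time intervals
   and over coordinates.                                                      *)
Record brownian_motion (B : R -> T -> 'rV[R]_d) : Prop := BrownianMotion {
  bm_measurable : forall t i, 0 <= t -> measurable_fun setT (fun w => B t w 0 i);
  bm_start : {ae P, forall w, B 0 w = 0};
  bm_gaussian : forall s t i, 0 <= s -> s < t ->
    forall A : set R, measurable A ->
      P ((fun w => B t w 0 i - B s w 0 i) @^-1` A)
      = normal_prob 0 (Num.sqrt (t - s)) A;
  bm_independent : forall (n : nat) (t : nat -> R),
    0 <= t 0%N -> nondecreasing_seq t ->
    mutually_independent (fun (ki : 'I_n * 'I_d) w =>
      B (t ki.1.+1) w 0 ki.2 - B (t ki.1) w 0 ki.2);
  bm_continuous : {ae P, forall w,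
    {within `[0, +oo[%classic, continuous (fun t => B t w)}} }.

Definition exit_time (A : set 'rV[R]_d) (path : R -> 'rV[R]_d) : \bar R :=
  ereal_inf [set t%:E | t in [set t : R | 0 <= t /\ boundary A (path t)]].

(* dX = b(X) dt + sqrt(2h) dB, X_0 = y: the noise is additive, so the equation
   involves no stochastic integral. It is required up to the exit time only,
   because for a drift [b] that is merely smooth a solution may explode after
   it has left the bounded set [A].                                           *)
Record sde_until_exit (A : set 'rV[R]_d) (b : 'rV[R]_d -> 'rV[R]_d) (h : R)
    (B : R -> T -> 'rV[R]_d) (y : 'rV[R]_d) (X : R -> T -> 'rV[R]_d) : Prop :=
  SdeUntilExit {
  sde_measurable : forall t i, 0 <= t -> measurable_fun setT (fun w => X t w 0 i);
  sde_continuous : forall w,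
    {within `[0, +oo[%classic, continuous (fun t => X t w)};
  sde_start : forall w, X 0 w = y;
  sde_equation : {ae P, forall w, forall t : R,
    0 <= t -> (t%:E <= exit_time A (X ^~ w))%E -> forall i,
    X t w 0 i = y 0 i
      + \int[lebesgue_measure]_(s in `[0, t]%classic) (b (X s w) 0 i)
      + Num.sqrt (2 * h) * B t w 0 i} }.

End Processes.

(* Main.v *)
Require Import Defs.
From HB Require Import structures.
From mathcomp Require Import all_boot all_order all_algebra.
From mathcomp Require Import all_classical all_reals all_analysis.
From mathcomp Require Import measurable_realfun.
From mathcomp Require Import ring lra.

Set Implicit Arguments.
Unset Strict Implicit.
Unset Printing Implicit Defensive.

Import Order.TTheory GRing.Theory Num.Theory.
Import numFieldNormedType.Exports.

Local Open Scope classical_set_scope.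
Local Open Scope ring_scope.

(** Write [tau] for the exit time of the process started at [x0 + x(h)],
    [beta = - <b(x0), nu(x0)> > 0] for the speed at which the drift points into
    the domain at [x0], and [u0 = - <x(h), nu(x0)>] for the initial height over
    the tangent plane. The theorem reduces to one estimate
    ([survival_probability]): there is a time [t0 > 0], fixed by the geometry
    near [x0], such that [P (tau >= t0) >= e^(- mu / h)] for every [mu > 0] and
    all small [h]. With [delta = lambda t0 / 2] and [mu = delta] it gives
    [E e^(lambda tau / h) >= e^(2 delta / h) P (tau >= t0) >= e^(delta / h)],
    which is the exponential bound and also exceeds the logarithmic one because
    [h log (1 / h) <= 1]. The tail estimate holds with the constant function
    [s = lambda t0 = 2 delta] and [c_alpha = 1], since
    [e^(- alpha (s - delta) / h) <= e^(- delta / h)] for [alpha > 1].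

    The survival estimate holds because, starting within distance [gamma h = h]
    of [x0], the drift wins against the noise [W = sqrt (2 h) B] with
    probability at least of order [h ^ N]. As the boundary is twice
    differentiable, the domain contains a paraboloid [u > K |z|^2] near [x0],
    where [z] is the displacement from [x0] and [u = - <z, nu>] its height
    ([interior_paraboloid]). As long as the path stays near [x0], its height is
    at least [u0 + beta t / 2 - <W_t, nu>], and its displacement is at most
    [|x(h)| + M t + |W_t|]. So the path remains in the paraboloid up to a small
    time [t0] as soon as ([stays_inside])

    - [<W_t, nu> <= u0 / 2 + beta t / 4], and
    - [|W_t|^2 <= kappa (u0 + t)] for a small constant [kappa];

    the term [|x(h)|^2] is negligible against [u0] by the cone condition on
    [x(h)]. By [line_crossing] the first condition fails with probability at
    most [e^(- u0 beta / (8 h))], which stays below [1] by an amount of order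
    [h ^ N]. By [parabola_crossing] the second one fails with probability at
    most a constant times [(t0 / u0 + 1) e^(- kappa / (4 h))], which is much
    smaller. The union bound leaves a probability of order [h ^ N].

    Both crossing estimates come from the maximal inequality for products of
    independent nonnegative variables of mean at most [1] ([ville]), applied
    to the exponential martingale [e^(2 q <v, B_t> - 2 q^2 t)] on finer and
    finer dyadic grids: where [<v, B_t>] exceeds [p + q t], this martingale
    exceeds [e^(2 p q)]. *)

(** * Products of independent variables *)

(** The joint law of [X] and [Y] agrees with the product of their laws on
    rectangles, hence everywhere, and Tonelli applies. *)
Lemma ge0_expectationM d (T : measurableType d) (R : realType)
    (P : probability T R) (X Y : T -> R) :
  measurable_fun setT X -> measurable_fun setT Y ->
  (forall w, 0 <= X w) -> (forall w, 0 <= Y w) ->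
  (forall A B, measurable A -> measurable B ->
    P (X @^-1` A `&` Y @^-1` B) = (P (X @^-1` A) * P (Y @^-1` B))%E) ->
  (\int[P]_w (X w * Y w)%:E = \int[P]_w (X w)%:E * \int[P]_w (Y w)%:E)%E.
Proof.
move=> mX mY X0 Y0 indep.
pose X' : {RV P >-> R} := HB.pack X (isMeasurableFun.Build _ _ _ _ X mX).
pose Y' : {RV P >-> R} := HB.pack Y (isMeasurableFun.Build _ _ _ _ Y mY).
have mXY : measurable_fun setT (fun w => (X w, Y w)).
  exact: measurable_fun_pair.
pose XY : {RV P >-> (R * R)%type} :=
  HB.pack (fun w => (X w, Y w)) (isMeasurableFun.Build _ _ _ _ _ mXY).
have lawE : forall C : set (R * R), measurable C ->
    (distribution P X' \x distribution P Y')%E C = distribution P XY C.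
  by apply: product_measure_unique => A B mA mB /=; exact: indep.
pose f (z : R * R) : \bar R := (`|z.1| * `|z.2|)%:E.
have mf : measurable_fun setT f.
  apply/measurable_EFinP; apply: measurable_funM; exact: measurableT_comp.
have f0 z : (0 <= f z)%E by rewrite lee_fin mulr_ge0.
have -> : (\int[P]_w (X w * Y w)%:E = \int[P]_w (f \o (fun w => (X w, Y w))) w)%E.
  by apply: eq_integral => w _; rewrite /f /= !ger0_norm.
rewrite -(ge0_integral_distribution XY mf f0).
transitivity (\int[(distribution P X' \x distribution P Y')%E]_z f z)%E.
  apply: eq_measure_integral => C mC _. exact: (esym (lawE C mC)).
rewrite fubini_tonelli1//= /fubini_F.
have mn : measurable_fun setT (fun x : R => `|x|%:E : \bar R).
  by apply/measurable_EFinP; exact: normr_measurable.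
have EY : (\int[distribution P Y']_y `|y|%:E = \int[P]_w (Y w)%:E)%E.
  rewrite (ge0_integral_distribution Y' mn)//.
  by apply: eq_integral => w _; rewrite /= ger0_norm.
have EX : (\int[distribution P X']_y `|y|%:E = \int[P]_w (X w)%:E)%E.
  rewrite (ge0_integral_distribution X' mn)//.
  by apply: eq_integral => w _; rewrite /= ger0_norm.
rewrite -EY -EX -ge0_integralZr//=.
- by apply: eq_integral => x _; rewrite -ge0_integralZl.
- by apply: integral_ge0 => y _; rewrite lee_fin.
Qed.

(** They generate the sigma-algebra of the coordinates listed in [s]. Working
    with a sigma-algebra on [T] itself, rather than with the joint law of these
    coordinates, turns the past into an ordinary measurable space. *)
Definition cylinders (T : Type) (R : realType) (I : finType) (Y : I -> T -> R)
    (s : seq I) : set (set T) :=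
  [set F | exists2 A : I -> set R, forall i, measurable (A i) &
    F = [set w | forall i, i \in s -> A i (Y i w)]].

Section IndependentProducts.
Variables (d : measure_display) (T : measurableType d) (R : realType).
Variables (P : probability T R) (I : finType) (Y : I -> T -> R).
Hypothesis mY : forall i, measurable_fun setT (Y i).
Hypothesis indY : mutually_independent P Y.

Lemma cylinders_measurable s : cylinders Y s `<=` measurable.
Proof.
move=> _ [A mA ->].
have -> : [set w | forall i, i \in s -> A i (Y i w)] =
    \bigcap_(i in [set` s]) (Y i @^-1` A i).
  by apply/seteqP; split => w /= H i; [move=> /H|exact: H].
apply: fin_bigcap_measurable => // i _; rewrite -[_ @^-1` _]setTI.
exact: mY.
Qed.

(** Both sides are finite measures in [F] that agree on cylinders. *)
Lemma past_independent s x F B : x \notin s -> measurable B ->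
  <<s cylinders Y s>> F ->
  P (F `&` Y x @^-1` B) = (P F * P (Y x @^-1` B))%E.
Proof.
move=> xs mB sF.
have mE : measurable (Y x @^-1` B) by rewrite -[_ @^-1` _]setTI; exact: mY.
have PEfin : P (Y x @^-1` B) \is a fin_num by exact: fin_num_measure.
pose r : {nonneg R} := NngNum (fine_ge0 (measure_ge0 P (Y x @^-1` B))).
have rE : (r%:num)%:E = P (Y x @^-1` B) by rewrite /= fineK.
have : mrestr P mE F = mscale r P F.
  apply: (g_sigma_algebra_measure_unique (cylinders Y s) _ (fun=> setT)) => //.
  - exact: cylinders_measurable.
  - move=> _; exists (fun=> setT) => //.
    by apply/seteqP; split.
  - by rewrite bigcup_const//; exists 0%N.
  - move=> _ _ [A mA ->] [C mC ->]; exists (fun i => A i `&` C i).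
      by move=> i; exact: measurableI.
    by apply/seteqP; split=> w /= => [[HA HC] i si|H]; [split; [exact: HA|exact: HC]|
      split=> i /H []].
  - move=> _ [A mA ->].
    change (P ([set w | forall i, i \in s -> A i (Y i w)] `&` Y x @^-1` B) =
      (r%:num%:E * P [set w | forall i, i \in s -> A i (Y i w)])%E); rewrite rE.
    pose A' i := if i \in s then A i else setT.
    have mA' i : measurable (A' i) by rewrite /A'; case: ifP.
    pose A'' i := if i == x then B else A' i.
    have mA'' i : measurable (A'' i) by rewrite /A''; case: ifP.
    have -> : [set w | forall i, i \in s -> A i (Y i w)] =
        [set w | forall i, A' i (Y i w)].
      apply/seteqP; split=> w /= H i; rewrite /A'; first by case: ifP => // /H.
      by move=> si; have := H i; rewrite /A' si.
    have -> : [set w | forall i, A' i (Y i w)] `&` Y x @^-1` B =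
        [set w | forall i, A'' i (Y i w)].
      apply/seteqP; split=> w /= => [[HA HB] i|H].
        by rewrite /A''; case: eqP => [->//|_]; exact: HA.
      split; last by have := H x; rewrite /A'' eqxx.
      move=> i; have := H i; rewrite /A''; case: eqP => // -> _.
      by rewrite /A' (negbTE xs).
    rewrite (indY mA') (indY mA'') (bigD1 x)//= (bigD1 x (F := fun i => P (Y i @^-1` A' i)))//=.
    rewrite /A'' eqxx {2}/A' (negbTE xs) preimage_setT probability_setT mul1e.
    by congr (_ * _)%E; apply: eq_bigr => i ix; rewrite (negbTE ix).
  - by move=> _; apply: le_lt_trans (ltry 1); apply: probability_le1; exact: measurableI.
by rewrite /mrestr /mscale rE muleC.
Qed.


(** Time runs backwards along lists: the head of [s] is the latest factor, so
    the partial products are those over suffixes. *)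
Definition hits (K : R) (s : seq I) : set T :=
  [set w | exists2 p, suffix p s & K <= \prod_(i <- p) Y i w].

Lemma coordinate_measurable s i : i \in s ->
  measurable_fun (setT : set (g_sigma_algebraType (cylinders Y s))) (Y i).
Proof.
move=> si _ B mB; rewrite setTI; apply: sub_sigma_algebra.
exists (fun j => if j == i then B else setT); first by move=> j; case: ifP.
apply/seteqP; split => w /= H; first by move=> j _; case: eqP => // ->.
by have := H i si; rewrite eqxx.
Qed.

Lemma suffix_consE (p s : seq I) x :
  suffix p (x :: s) = (p == x :: s) || suffix p s.
Proof.
apply/idP/orP => [/suffixP[[|y q]]/=|[/eqP ->|]].
- by move=> <-; left.
- by move=> [_ ->]; right; exact: suffix_suffix.
- exact: suffix_refl.
- by move/suffix_trans; apply; exact: suffix_cons.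
Qed.

Lemma hits_cons K s x :
  hits K (x :: s) = hits K s `|` [set w | K <= \prod_(i <- x :: s) Y i w].
Proof.
apply/seteqP; split=> w /=.
  move=> [p]; rewrite suffix_consE => /orP[/eqP ->|ps Kp]; first by right.
  by left; exists p.
move=> [[p ps Kp]|Kp]; last by exists (x :: s) => //; exact: suffix_refl.
by exists p => //; rewrite suffix_consE ps orbT.
Qed.

Lemma hits_measurable_past K s u : {subset s <= u} ->
  measurable (hits K s : set (g_sigma_algebraType (cylinders Y u))).
Proof.
have mle (v : seq I) : {subset v <= u} -> measurable
    ([set w | K <= \prod_(i <- v) Y i w] :
      set (g_sigma_algebraType (cylinders Y u))).
  move=> vu; rewrite -[X in measurable X]setTI.
  apply: measurable_fun_le => //; apply: measurable_prod => i /vu iu.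
  exact: coordinate_measurable.
elim: s => [_|x s IH xsu]; last first.
  rewrite hits_cons; apply: measurableU; last exact: mle.
  by apply: IH => i si; apply: xsu; rewrite inE si orbT.
have -> : hits K [::] = [set w | K <= \prod_(i <- [::]) Y i w].
  apply/seteqP; split=> w /=; last by move=> ?; exists [::].
  by move=> [p]; rewrite suffixs0 => /eqP ->.
exact: mle.
Qed.

Lemma past_measurable s F : <<s cylinders Y s>> F -> measurable F.
Proof. by apply: smallest_sub F; [exact: sigma_algebra_measurable|exact: cylinders_measurable]. Qed.

Lemma hits_measurable K s : measurable (hits K s).
Proof. by apply: past_measurable (hits_measurable_past K (fun i (h : i \in s) => h)). Qed.

Hypothesis Y_ge0 : forall i w, 0 <= Y i w.
Hypothesis EY_le1 : forall i, (\int[P]_w (Y i w)%:E <= 1)%E.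

(** The product process, killed when it first reaches [K]. *)
Definition stopped_product K s w : R :=
  \prod_(i <- s) Y i w * \1_(~` hits K s) w.

Lemma stopped_product_measurable_past K s :
  measurable_fun (setT : set (g_sigma_algebraType (cylinders Y s)))
    (stopped_product K s).
Proof.
apply: measurable_funM.
  by apply: measurable_prod => i; exact: coordinate_measurable.
by apply: measurable_indic; apply: measurableC; exact: hits_measurable_past.
Qed.

Lemma stopped_product_ge0 K s w : 0 <= stopped_product K s w.
Proof. by rewrite mulr_ge0// prodr_ge0. Qed.

Lemma stopped_product_measurable K s : measurable_fun setT (stopped_product K s).
Proof.
move=> _ B mB; apply: (@past_measurable s).
exact: stopped_product_measurable_past.
Qed.

Lemma stopped_productM K s x : x \notin s ->
  (\int[P]_w (stopped_product K s w * Y x w)%:E =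
   \int[P]_w (stopped_product K s w)%:E * \int[P]_w (Y x w)%:E)%E.
Proof.
move=> xs; apply: ge0_expectationM => //.
- exact: stopped_product_measurable.
- exact: stopped_product_ge0.
- move=> A B mA mB; apply: (past_independent xs mB).
  by rewrite -[X in <<s _ >> X]setTI; exact: stopped_product_measurable_past.
Qed.

(** The expectation of the killed process plus what it is worth at its killing
    time cannot grow: a new factor is independent of the past and has mean at
    most [1], and the paths it kills have reached the value [K]. *)
Lemma stopped_product_invariant K s : 0 < K -> uniq s ->
  (\int[P]_w (stopped_product K s w)%:E + K%:E * P (hits K s) <= 1)%E.
Proof.
move=> K0; elim: s => [_|x s IH /= /andP[xs us]].
  have [K1|K1] := leP K 1.
    have -> : hits K [::] = setT.
      by apply/seteqP; split=> w //= _; exists [::] => //; rewrite big_nil.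
    rewrite probability_setT mule1 (_ : (\int[P]_w _ = 0)%E) ?add0e//.
    apply: integral0_eq => w _; rewrite /stopped_product /hits.
    rewrite indicE memNset ?mulr0// => /=; apply.
    by exists [::] => //; rewrite big_nil.
  have -> : hits K [::] = set0.
    apply/seteqP; split=> w //= [p]; rewrite suffixs0 => /eqP ->.
    by rewrite big_nil leNgt K1.
  rewrite measure0 mule0 adde0.
  apply: (@le_trans _ _ (\int[P]_w (cst 1 w))%E); last first.
    by rewrite integral_cst//= mul1e probability_setT.
  apply: ge0_le_integral => //.
  - by move=> w _; rewrite lee_fin stopped_product_ge0.
  - by apply/measurable_EFinP; exact: stopped_product_measurable.
  - move=> w _; rewrite /stopped_product big_nil mul1r lee_fin indicE.
    by case: (_ \in _).
apply: le_trans (IH us).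
pose new := [set w | K <= \prod_(i <- x :: s) Y i w] `&` ~` hits K s.
have mnew : measurable new.
  apply: measurableI; last by apply: measurableC; exact: hits_measurable.
  rewrite -[X in measurable X]setTI; apply: measurable_fun_le => //.
  by apply: measurable_prod.
have -> : hits K (x :: s) = hits K s `|` new by rewrite /new setUIr setUv setIT hits_cons.
rewrite measureU//; last 2 first.
- exact: hits_measurable.
- by rewrite /new setIA setIC setIA setICl set0I.
rewrite ge0_muleDr// addeCA [leRHS]addeC; apply: leeD2l.
have -> : (K%:E * P new = \int[P]_w (K * \1_new w)%:E)%E.
  under eq_integral do rewrite EFinM.
  rewrite ge0_integralZl//= ?integral_indic ?setIT ?lee_fin ?ltW//.
  by apply/measurable_EFinP; exact: measurable_indic.
have mK : measurable_fun setT (fun w => (K * \1_new w)%:E).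
  by apply/measurable_EFinP; apply: measurable_funM => //; exact: measurable_indic.
have K1_ge0 w : (0 <= (K * \1_new w)%:E)%E by rewrite lee_fin mulr_ge0// ltW.
rewrite -ge0_integralD//; last 2 first.
- by move=> w _; rewrite lee_fin stopped_product_ge0.
- by apply/measurable_EFinP; exact: stopped_product_measurable.
apply: (@le_trans _ _ (\int[P]_w (stopped_product K s w * Y x w)%:E)%E); last first.
  rewrite stopped_productM// -[leRHS]mule1; apply: lee_wpmul2l => //.
  by apply: integral_ge0 => w _; rewrite lee_fin stopped_product_ge0.
apply: ge0_le_integral => //.
- by move=> w _; rewrite adde_ge0// lee_fin stopped_product_ge0.
- by apply: emeasurable_funD => //; apply/measurable_EFinP; exact: stopped_product_measurable.
- apply/measurable_EFinP/measurable_funM => //.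
  exact: stopped_product_measurable.
- move=> w _; rewrite -EFinD lee_fin /stopped_product mulrAC.
  have -> : \prod_(i <- s) Y i w * Y x w = \prod_(i <- x :: s) Y i w.
    by rewrite big_cons mulrC.
  have p0 : 0 <= \prod_(i <- x :: s) Y i w by rewrite prodr_ge0.
  rewrite hits_cons /new !indicE !(in_setC, in_setI, in_setU).
  have -> : (w \in [set w | K <= \prod_(i <- x :: s) Y i w]) =
      (K <= \prod_(i <- x :: s) Y i w) by apply/idP/idP; rewrite inE.
  case: (w \in hits K s) => /=; first by rewrite andbF !mulr0 addr0.
  rewrite andbT mulr1; have [Kp|Kp] := boolP (K <= _).
    by rewrite mulr0 add0r mulr1.
  by rewrite mulr1 mulr0 addr0.
Qed.

(** Ville's inequality: the killed product is nonnegative, so the invariant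
    bounds [K] times the probability of being killed. *)
Lemma ville K s : 0 < K -> uniq s -> (P (hits K s) <= K^-1%:E)%E.
Proof.
move=> K0 us; have := stopped_product_invariant K0 us.
have Pfin : P (hits K s) \is a fin_num.
  by apply: fin_num_measure; exact: hits_measurable.
move=> inv; have : (K%:E * P (hits K s) <= 1)%E.
  apply: le_trans inv; rewrite leeDr//.
  by apply: integral_ge0 => w _; rewrite lee_fin stopped_product_ge0.
rewrite -(fineK Pfin) -EFinM !lee_fin => KP.
by rewrite -(ler_pM2l K0) divff// gt_eqF.
Qed.

End IndependentProducts.

(** * The exponential martingale of a Gaussian increment *)

(** The density is, up to a null set, the Radon-Nikodym derivative. *)
Lemma ge0_integral_normal_prob (R : realType) (m s : R) (f : R -> \bar R) :
  measurable_fun setT f -> (forall x, 0 <= f x)%E ->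
  (\int[normal_prob m s]_x f x =
   \int[lebesgue_measure]_x (f x * (normal_pdf m s x)%:E))%E.
Proof.
move=> mf f0.
have dom := normal_prob_dominates m s.
rewrite -(Radon_Nikodym_SigmaFinite.change_of_variables dom f0 measurableT mf).
apply: ae_eq_integral => //.
- apply: emeasurable_funM => //.
  exact: measurable_int (Radon_Nikodym_SigmaFinite.f_integrable _).
- apply: emeasurable_funM => //; apply/measurable_EFinP.
  exact: measurable_normal_pdf.
apply: ae_eqe_mul2l; apply: integral_ae_eq => //.
- exact: Radon_Nikodym_SigmaFinite.f_integrable.
- by apply/measurable_EFinP; exact: measurable_normal_pdf.
- by move=> A _ mA; rewrite -Radon_Nikodym_SigmaFinite.f_integral.
Qed.

Lemma normal_pdf_tilt (R : realType) (s c x : R) : s != 0 ->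
  expR (c * x - c ^+ 2 * s ^+ 2 / 2) * normal_pdf 0 s x =
  normal_pdf (c * s ^+ 2) s x.
Proof.
move=> s0; rewrite !normal_pdfE// mulrCA; congr (_ * _).
rewrite /normal_fun -expRD; congr expR; field.
by rewrite s0.
Qed.

(** By [normal_pdf_tilt] the exponential turns the centred density into the
    density with mean [c s^2], whose total mass is [1]. *)
Lemma normal_mgf (R : realType) d (T : measurableType d) (P : probability T R)
    (X : T -> R) (s c : R) : s != 0 -> measurable_fun setT X ->
  (forall A, measurable A -> P (X @^-1` A) = normal_prob 0 s A) ->
  (\int[P]_w (expR (c * X w - c ^+ 2 * s ^+ 2 / 2))%:E = 1)%E.
Proof.
move=> s0 mX lawX.
have mX' : measurable_fun setT (X : T -> measurableTypeR R) by exact: mX.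
pose X' : {RV P >-> measurableTypeR R} :=
  HB.pack (X : T -> measurableTypeR R) (isMeasurableFun.Build _ _ _ _ _ mX').
pose f (x : R) : \bar R := (expR (c * x - c ^+ 2 * s ^+ 2 / 2))%:E.
have mf : measurable_fun setT f.
  apply/measurable_EFinP; apply: measurableT_comp => //.
  apply: measurable_funB => //; exact: measurable_funM.
have f0 x : (0 <= f x)%E by rewrite lee_fin expR_ge0.
rewrite -[LHS]/(\int[P]_w (f \o X') w)%E -(ge0_integral_distribution X' mf f0).
transitivity (\int[normal_prob 0 s]_x f x)%E.
  by apply: eq_measure_integral => A mA _; exact: lawX.
rewrite ge0_integral_normal_prob//.
transitivity (\int[lebesgue_measure]_x (normal_pdf (c * s ^+ 2) s x)%:E)%E.
  by apply: eq_integral => x _; rewrite /f -EFinM normal_pdf_tilt.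
exact: integral_normal_pdf.
Qed.

(** * Row vectors, continuous paths and dyadic times *)

Section RowVectors.
Variables (R : realType) (n : nat).
Implicit Types (x y v : 'rV[R]_n) (c : R).

Lemma coord_le_norm x i : `|x 0 i| <= `|x|.
Proof.
rewrite [leRHS]mx_normrE.
by apply: (le_bigmax_cond _ (fun ij : 'I_1 * 'I_n => `|x ij.1 ij.2|) (j := (0, i))).
Qed.

Lemma norm_le_coord x c : 0 <= c -> (forall i, `|x 0 i| <= c) -> `|x| <= c.
Proof.
move=> c0 xc; rewrite [leLHS]mx_normrE; apply/bigmax_leP; split => // -[i j] _ /=.
by rewrite ord1.
Qed.

Lemma dotDr v x y : dot v (x + y) = dot v x + dot v y.
Proof. by rewrite -big_split; apply: eq_bigr => i _; rewrite mxE mulrDr. Qed.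

Lemma dotZr v c x : dot v (c *: x) = c * dot v x.
Proof. by rewrite mulr_sumr; apply: eq_bigr => i _; rewrite mxE mulrCA. Qed.

Lemma dotNr v x : dot v (- x) = - dot v x.
Proof. by rewrite -scaleN1r dotZr mulN1r. Qed.

Lemma dotBr v x y : dot v (x - y) = dot v x - dot v y.
Proof. by rewrite dotDr dotNr. Qed.

Lemma dotC x y : dot x y = dot y x.
Proof. by apply: eq_bigr => i _; rewrite mulrC. Qed.

Lemma dot_delta i x : dot (delta_mx 0 i) x = x 0 i.
Proof.
rewrite /dot (bigD1 i)//= big1 ?addr0 => [|j /negbTE ji]; rewrite mxE eqxx.
  by rewrite eqxx mul1r.
by rewrite ji mul0r.
Qed.

Lemma dot_ge0 x : 0 <= dot x x.
Proof. by apply: sumr_ge0 => i _; rewrite -expr2 sqr_ge0. Qed.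

Lemma sqr_enorm x : enorm x ^+ 2 = dot x x.
Proof. by rewrite sqr_sqrtr// dot_ge0. Qed.

Lemma coord_le_enorm x i : `|x 0 i| <= enorm x.
Proof.
rewrite -sqrtr_sqr ler_sqrt ?dot_ge0// /dot (bigD1 i)//= -expr2 lerDl.
by apply: sumr_ge0 => j _; rewrite -expr2 sqr_ge0.
Qed.

Lemma norm_le_enorm x : `|x| <= enorm x.
Proof. by apply: norm_le_coord => [|i]; rewrite ?sqrtr_ge0 ?coord_le_enorm. Qed.

Lemma dot_norm_le x y : (forall i, `|y 0 i| <= 1) -> `|dot x y| <= n%:R * `|x|.
Proof.
move=> y1; apply: le_trans (ler_norm_sum _ _ _) _.
rewrite -[X in X%:R]card_ord -sum1_card natr_sum mulr_suml.
apply: ler_sum => i _; rewrite normrM mul1r -[leRHS]mulr1.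
by rewrite ler_pM// coord_le_norm.
Qed.

End RowVectors.

Section Paths.
Variables (R : realType) (V : normedModType R) (f : R -> V).
Hypothesis cf : {within `[0, +oo[, continuous f}.

Lemma path_near t e : 0 <= t -> 0 < e ->
  exists2 r, 0 < r & forall s, 0 <= s -> `|s - t| < r -> `|f s - f t| < e.
Proof.
move=> t0 e0; have /subspace_continuousP := cf.
move=> /(_ t); rewrite /= in_itv/= t0 => /(_ isT)/cvgrPdist_lt/(_ e e0).
move=> /nbhs_ballP[r /= r0 H]; exists r => // s s0 st.
rewrite distrC; apply: (H s); last by rewrite /= in_itv/= s0.
by rewrite /ball/= distrC.
Qed.

End Paths.

Lemma pow2_archimed (R : realType) (x : R) : exists m, x < (2 ^ m)%:R.
Proof.
exists (Num.trunc x).+1; apply: lt_trans (truncnS_gt x) _.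
by rewrite ltr_nat ltn_expl.
Qed.

Lemma dyadic_approx (R : realType) (T t r : R) : 0 < T -> 0 <= t <= T -> 0 < r ->
  exists m k, (k <= 2 ^ m)%N /\ `|k%:R * (T / (2 ^ m)%:R) - t| < r.
Proof.
move=> T0 /andP[t0 tT] r0; have [m Tm] := pow2_archimed (T / r).
have p0 : 0 < (2 ^ m)%:R :> R by rewrite ltr0n expn_gt0.
have dr : T / (2 ^ m)%:R < r.
  by rewrite ltr_pdivrMr// mulrC -ltr_pdivrMr.
have d0 : 0 < T / (2 ^ m)%:R by rewrite divr_gt0.
have q0 : 0 <= t / (T / (2 ^ m)%:R) by rewrite divr_ge0// ltW.
exists m, (Num.trunc (t / (T / (2 ^ m)%:R))); have /andP[lo hi] := truncn_itv q0.
split.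
  rewrite -(ler_nat R); apply: le_trans lo _.
  by rewrite ler_pdivrMr// mulrCA divff ?gt_eqF// mulr1.
rewrite ler_pdivlMr// in lo; rewrite ltr_pdivrMr// -natr1 mulrDl mul1r in hi.
rewrite ltr_norml; apply/andP; split; lra.
Qed.

(** * Brownian motion crossing lines *)

Section LineCrossing.
Variables (R : realType) (dim : nat) (d : measure_display).
Variables (T : measurableType d) (P : probability T R).
Variables (B : R -> T -> 'rV[R]_dim).
Hypothesis bmB : brownian_motion P B.
Variables (v : 'rV[R]_dim) (p q : R).
Hypotheses (unit_v : dot v v = 1) (q_gt0 : 0 < q).

Let displacement t w := dot v (B t w - B 0 w).

Let displacement_measurable t : 0 <= t -> measurable_fun setT (displacement t).
Proof.
move=> t0; apply: measurable_sum => i; apply: measurable_funM => //.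
have -> : (fun w => (B t w - B 0 w) 0 i) = (fun w => B t w 0 i - B 0 w 0 i).
  by apply/funext => w; rewrite !mxE.
by apply: measurable_funB; exact: bm_measurable bmB _ _ _.
Qed.

Section Grid.
Variables (n : nat) (D : R).
Hypothesis D_gt0 : 0 < D.

Let increment (k : nat) (i : 'I_dim) w := B (k.+1%:R * D) w 0 i - B (k%:R * D) w 0 i.

(** The exponential martingale of slope [2 q] along [v], split into one factor
    per time step and coordinate. *)
Let factor (ki : 'I_n * 'I_dim) w :=
  expR (2 * q * v 0 ki.2 * increment ki.1 ki.2 w
        - (2 * q * v 0 ki.2) ^+ 2 * D / 2).

Let increment_measurable k i : measurable_fun setT (increment k i).
Proof.
by apply: measurable_funB; apply: (bm_measurable bmB); rewrite mulr_ge0// ltW.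
Qed.

Let affine_measurable (a b : R) : measurable_fun setT (fun x : R => expR (a * x - b)).
Proof.
by apply: measurableT_comp => //; exact: measurable_funB.
Qed.

Let factor_measurable ki : measurable_fun setT (factor ki).
Proof. exact: (measurableT_comp (affine_measurable _ _) (increment_measurable _ _)). Qed.

Let factor_independent : mutually_independent P factor.
Proof.
have D_nd : nondecreasing_seq (fun k : nat => k%:R * D).
  by move=> k l kl; rewrite ler_pM2r// ler_nat.
have D0 : 0 <= 0%:R * D by rewrite mul0r.
move=> A mA; pose A' (ki : 'I_n * 'I_dim) := (fun x =>
  expR (2 * q * v 0 ki.2 * x - (2 * q * v 0 ki.2) ^+ 2 * D / 2)) @^-1` A ki.
have mA' ki : measurable (A' ki).
  by rewrite -[A' ki]setTI; apply: affine_measurable.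
exact: (bm_independent bmB D0 D_nd mA').
Qed.

Let factor_mean ki : (\int[P]_w (factor ki w)%:E <= 1)%E.
Proof.
have stepD : ki.1.+1%:R * D - ki.1%:R * D = D by rewrite -natr1 mulrDl mul1r addrAC subrr add0r.
have := @normal_mgf R _ T P (increment ki.1 ki.2) (Num.sqrt D) (2 * q * v 0 ki.2).
rewrite sqr_sqrtr ?(ltW D_gt0)// => ->//.
  by rewrite gt_eqF// sqrtr_gt0.
move=> A mA; rewrite -[X in Num.sqrt X]stepD; apply: (bm_gaussian bmB) => //.
  by rewrite mulr_ge0// ltW.
by rewrite ltr_pM2r// ltr_nat.
Qed.

(* Latest time first, so that each [past k] is a suffix of [past n]. *)
Let past (k : nat) : seq ('I_n * 'I_dim) :=
  [seq (j, i) | j <- rev (take k (enum 'I_n)), i <- enum 'I_dim].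

Let past_suffix k : suffix (past k) (past n).
Proof.
rewrite /past (@take_oversize _ n (enum 'I_n)) ?size_enum_ord//.
have -> : rev (enum 'I_n) = rev (drop k (enum 'I_n)) ++ rev (take k (enum 'I_n)).
  by rewrite -rev_cat cat_take_drop.
by rewrite allpairs_cat suffix_suffix.
Qed.

Let past_product k w : (k <= n)%N ->
  \prod_(ki <- past k) factor ki w =
  expR (2 * q * displacement (k%:R * D) w - 2 * q ^+ 2 * (k%:R * D)).
Proof.
move=> kn; rewrite big_allpairs/= big_rev/=.
have -> : \prod_(j <- take k (enum 'I_n)) \prod_(i <- enum 'I_dim) factor (j, i) w =
    \prod_(j <- iota 0 k) \prod_(i < dim)
      expR (2 * q * v 0 i * increment j i w - (2 * q * v 0 i) ^+ 2 * D / 2).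
  have -> : iota 0 k = map val (take k (enum 'I_n)).
    by rewrite map_take val_enum_ord take_iota (minn_idPl kn).
  by rewrite big_map; apply: eq_bigr => j _; rewrite big_enum.
elim: k kn => [_|k IH kn].
  rewrite big_nil mul0r /displacement subrr /dot big1 ?mulr0 ?subrr ?expR0//.
  by move=> i _; rewrite mxE mulr0.
have -> : iota 0 k.+1 = rcons (iota 0 k) k by rewrite -[in LHS](addn1 k) iotaD cats1.
rewrite big_rcons/= IH; last exact: ltnW.
rewrite -expR_sum -expRD; congr expR.
rewrite /displacement sumrB -mulr_suml.
have -> : \sum_(i < dim) (2 * q * v 0 i) ^+ 2 * D = 4 * q ^+ 2 * D.
  have v1 : \sum_(i < dim) v 0 i ^+ 2 = 1.
    by rewrite -[RHS]unit_v; apply: eq_bigr => i _; rewrite expr2.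
  transitivity (4 * q ^+ 2 * D * \sum_(i < dim) v 0 i ^+ 2).
    by rewrite mulr_sumr; apply: eq_bigr => i _; ring.
  by rewrite v1 mulr1.
have -> : \sum_(i < dim) 2 * q * v 0 i * increment k i w =
    2 * q * (dot v (B (k.+1%:R * D) w) - dot v (B (k%:R * D) w)).
  rewrite -dotBr /dot mulr_sumr; apply: eq_bigr => i _.
  by rewrite !mxE /increment mulrA.
by rewrite !dotBr -natr1; field.
Qed.

Definition crossing_at (k : nat) (D : R) : set T :=
  [set w | p + q * (k%:R * D) < dot v (B (k%:R * D) w - B 0 w)].

Lemma crossing_at_measurable k : measurable (crossing_at k D).
Proof.
have kD : 0 <= k%:R * D by rewrite mulr_ge0// ltW.
have -> : crossing_at k D = displacement (k%:R * D) @^-1` `]p + q * (k%:R * D), +oo[.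
  by apply/seteqP; split => w; rewrite /crossing_at /= in_itv/= andbT.
by rewrite -[X in measurable X]setTI; apply: (displacement_measurable kD).
Qed.

(** On a crossing the exponential martingale exceeds [expR (2 * p * q)]. *)
Lemma grid_crossing_le :
  (P (\bigcup_(k in [set k | (k <= n)%N]) crossing_at k D) <=
   (expR (- (2 * p * q)))%:E)%E.
Proof.
have := @ville _ T R P _ factor factor_measurable factor_independent
  (fun ki w => expR_ge0 _) factor_mean (expR (2 * p * q)) (past n) (expR_gt0 _).
have upast : uniq (past n).
  rewrite /past allpairs_uniq ?rev_uniq ?take_uniq ?enum_uniq//.
  by move=> [? ?] [? ?] _ _ [-> ->].
move=> /(_ upast); rewrite -expRN; apply: le_trans.
apply: le_measure; rewrite ?inE.
- apply: bigcup_measurable => k _; exact: crossing_at_measurable.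
- exact: hits_measurable.
move=> w [k /= kn cross]; exists (past k); first exact: past_suffix.
rewrite past_product// ler_expR /displacement.
move: cross; rewrite /crossing_at /=; set u := dot _ _; set t := k%:R * D.
rewrite -subr_gt0 => cross; rewrite -subr_ge0.
have -> : 2 * q * u - 2 * q ^+ 2 * t - 2 * p * q = 2 * q * (u - (p + q * t)) by ring.
by rewrite mulr_ge0// ?mulr_ge0// ltW.
Qed.

End Grid.

Let dyadic_crossing (H : R) (m : nat) : set T :=
  \bigcup_(k in [set k | (k <= 2 ^ m)%N]) crossing_at k (H / (2 ^ m)%:R).

Let dyadic_crossing_nd H : {homo dyadic_crossing H : m l / (m <= l)%N >-> (m <= l)%O}.
Proof.
move=> m l ml; rewrite subsetEset => w [k /= km cross].
exists (k * 2 ^ (l - m))%N => /=.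
  by rewrite -[in leqRHS](subnK ml) expnD mulnC leq_mul2l km orbT.
move: cross; rewrite /crossing_at.
suff -> : (k * 2 ^ (l - m))%:R * (H / (2 ^ l)%:R) = k%:R * (H / (2 ^ m)%:R) by [].
rewrite -[in (2 ^ l)%N](subnK ml) expnD !natrM; field.
by rewrite !pnatr_eq0 -!lt0n !expn_gt0.
Qed.

(** Continuity of the paths makes a crossing visible at a dyadic time, and the
    dyadic grids increase, so the bound for grids passes to the limit. The
    conclusion is stated off an exceptional set that also contains the null
    sets of the definition of Brownian motion; this makes it usable path by
    path, and several such bounds are combined by adding the measures of their
    exceptional sets. *)
Lemma line_crossing (H : R) : 0 < H ->
  exists2 N : set T, measurable N /\ (P N <= (expR (- (2 * p * q)))%:E)%E &
    forall w, ~ N w -> forall t, 0 <= t <= H -> dot v (B t w) <= p + q * t.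
Proof.
move=> H0; have D0 m : 0 < H / (2 ^ m)%:R by rewrite divr_gt0// ltr0n expn_gt0.
have mA m : measurable (dyadic_crossing H m).
  by apply: bigcup_measurable => k _; exact: crossing_at_measurable.
have mUA : measurable (\bigcup_m dyadic_crossing H m) by exact: bigcupT_measurable.
have cvA := nondecreasing_cvg_mu (mu := P) mA mUA (@dyadic_crossing_nd H).
have PA : (P (\bigcup_m dyadic_crossing H m) <= (expR (- (2 * p * q)))%:E)%E.
  rewrite -(cvg_lim _ cvA)//; apply: lime_le; first by apply/cvg_ex; eexists; exact: cvA.
  by apply: nearW => m; exact: grid_crossing_le.
have [N0 [mN0 PN0 sN0]] := bm_start bmB.
have [Nc [mNc PNc sNc]] := bm_continuous bmB.
exists (\bigcup_m dyadic_crossing H m `|` (N0 `|` Nc)).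
  split; first by do !apply: measurableU.
  apply: le_trans (measureU2 _ _ _) _ => //; first exact: measurableU.
  rewrite -[leRHS]adde0; apply: leeD => //.
  apply: (le_trans (measureU2 P mN0 mNc)).
  by rewrite -[leRHS]adde0; apply: leeD; rewrite le_eqVlt; apply/orP; left; apply/eqP.
move=> w Nw t tH.
have B0 : B 0 w = 0 by apply: contrapT => H1; apply: Nw; right; left; exact: sN0.
have cB : {within `[0, +oo[, continuous (fun t => B t w)}.
  by apply: contrapT => H1; apply: Nw; right; right; exact: sNc.
rewrite leNgt; apply/negP => cross.
pose gap := dot v (B t w) - (p + q * t).
have gap0 : 0 < gap by rewrite subr_gt0.
have v1 i : `|v 0 i| <= 1.
  by apply: le_trans (coord_le_enorm v i) _; rewrite /enorm unit_v sqrtr1.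
have dim0 : 0 < dim%:R + 1 :> R by rewrite ltr_wpDl.
have t0 : 0 <= t by case/andP: tH.
have [|r r0 near_t] := path_near cB t0 (e := gap / 2 / (dim%:R + 1)).
  by rewrite !divr_gt0.
have [|m [k [km ks]]] := dyadic_approx H0 tH (r := Num.min r (gap / 2 / q)).
  by rewrite lt_min r0 !divr_gt0.
move: ks; set s := k%:R * _; rewrite lt_min => /andP[sr sg].
apply: Nw; left; exists m => //; exists k => //.
rewrite /crossing_at /= -/s B0 subr0.
have /near_t/(_ sr) Bst : 0 <= s by rewrite mulr_ge0// ltW.
have : `|dot v (B s w - B t w)| < gap / 2.
  rewrite dotC; apply: le_lt_trans (dot_norm_le _ v1) _.
  rewrite ltr_pdivlMr// in Bst; apply: le_lt_trans Bst.
  by rewrite mulrC ler_wpM2l// lerDl.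
rewrite dotBr ltr_norml => /andP[+ _].
have : q * (s - t) < gap / 2.
  by rewrite mulrC -ltr_pdivlMr//; apply: le_lt_trans (ler_norm _) sg.
rewrite /gap; lra.
Qed.

End LineCrossing.

(** * Measurability of the exit time *)

Section OpenMeasurable.
Variables (R : realType) (n : nat) (d : measure_display) (T : measurableType d).

(** Rational boxes form a countable base of the topology. *)
Lemma open_preimage_measurable (Y : T -> 'rV[R]_n) (U : set 'rV[R]_n) :
  (forall i, measurable_fun setT (fun w => Y w 0 i)) -> open U ->
  measurable (Y @^-1` U).
Proof.
move=> mY oU.
pose box (ak : 'rV[rat]_n * nat) : set 'rV[R]_n :=
  [set x | forall i, `|x 0 i - ratr (ak.1 0 i)| < ak.2.+1%:R^-1].
have mbox ak : measurable (Y @^-1` box ak).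
  have -> : Y @^-1` box ak = \bigcap_(i in [set: 'I_n])
      ((fun w => Y w 0 i) @^-1` ball (ratr (ak.1 0 i) : R) ak.2.+1%:R^-1).
    apply/seteqP; split=> w /= H i; last by rewrite distrC; exact: H.
    by move=> _; rewrite /ball/= distrC; exact: H.
  apply: fin_bigcap_measurable => // i _.
  by rewrite -[_ @^-1` _]setTI; apply: mY => //; exact: measurable_ball.
have -> : Y @^-1` U = \bigcup_ak
    (if pselect (box ak `<=` U) then Y @^-1` box ak else set0).
  apply/seteqP; split=> w /=; last first.
    by move=> [ak _]; case: pselect => // boxU; exact: boxU.
  move=> Uw; have [e e0 eU] := (nbhs_ballP _ _).1 (open_nbhs_nbhs (conj oU Uw)).
  have [k _ ke] := near_infty_natSinv_lt (PosNum (divr_gt0 e0 (@ltr0n R 2))).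
  have {}ke : k.+1%:R^-1 < e / 2 by exact: (ke k (leqnn k)).
  have k0 : 0 < k.+1%:R^-1 :> R by rewrite invr_gt0 ltr0n.
  have /choice[a aP] : forall i, exists q : rat, `|Y w 0 i - ratr q| < k.+1%:R^-1.
    move=> i; have [|q] := @rat_in_itvoo R (Y w 0 i) (Y w 0 i + k.+1%:R^-1).
      by rewrite ltrDl.
    rewrite in_itv/= => /andP[q1 q2]; exists q.
    by rewrite distrC ger0_norm ?subr_ge0 ?ltW// ltrBlDl.
  exists (\row_i a i, k) => //; case: pselect => [_ i|[]] /=.
    by rewrite mxE; exact: aP.
  move=> x xbox; apply: eU; rewrite -ball_normE /=.
  apply: le_lt_trans (_ : `|Y w - x| <= 2 * k.+1%:R^-1) _; last by rewrite mulrC -ltr_pdivlMr.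
  apply: norm_le_coord => [|i]; first by rewrite mulr_ge0// ltW.
  have := xbox i; rewrite /= !mxE => xi; rewrite (le_trans (ler_distD (ratr (a i)) _ _))//.
  by rewrite mulr_natl mulr2n lerD// ltW// distrC.
apply: countable_bigcupT_measurable; first exact: countableP.
by move=> ak; case: pselect => ?; [exact: mbox|exact: measurable0].
Qed.

End OpenMeasurable.

Section ExitTime.
Variables (R : realType) (n : nat).
Implicit Types (A F : set 'rV[R]_n) (f : R -> 'rV[R]_n).

Lemma boundary_closed A : closed (boundary A).
Proof.
rewrite /boundary setDE; apply: closedI; first exact: closed_closure.
exact/open_closedC/open_interior.
Qed.

Lemma le_exit_time A f (s : R) :
  (s%:E <= exit_time A f)%E <-> forall t, 0 <= t < s -> ~ boundary A (f t).
Proof.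
split=> [sA t /andP[t0 ts] At|H].
  have : (s%:E <= t%:E)%E by apply: le_trans sA _; apply: ereal_inf_lbound; exists t.
  by rewrite lee_fin leNgt ts.
apply: le_ereal_inf_tmp => _ [t [t0 At] <-]; rewrite lee_fin leNgt; apply/negP => ts.
by apply: (H t) => //; rewrite t0.
Qed.

Let thicken F (j : nat) : set 'rV[R]_n :=
  [set x | exists2 y, F y & `|x - y| < j.+1%:R^-1].

Let thicken_open F j : open (thicken F j).
Proof.
rewrite openE => x [y Fy xy]; apply/nbhs_ballP.
exists (j.+1%:R^-1 - `|x - y|) => /=; first by rewrite subr_gt0.
move=> z; rewrite -ball_normE /= ltrBrDr => xz; exists y => //.
by apply: le_lt_trans xz; rewrite [`|x - z|]distrC; exact: ler_distD.
Qed.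

(** Continuity gives one direction, compactness of the time interval the other.
    The right-hand side is a countable condition. *)
Let hit_dyadic F f (c : R) : closed F -> 0 < c ->
  {within `[0, +oo[, continuous f} ->
  (exists2 t, 0 <= t <= c & F (f t)) <->
  (forall j, exists m k, (k <= 2 ^ m)%N /\ thicken F j (f (k%:R * (c / (2 ^ m)%:R)))).
Proof.
move=> cF c0 cf; split=> [[t tc Ft] j|H].
  have t0 : 0 <= t by case/andP: tc.
  have [|r r0 near_t] := path_near cf t0 (e := j.+1%:R^-1); first by rewrite invr_gt0 ltr0n.
  have [m [k [km ks]]] := dyadic_approx c0 tc r0.
  exists m, k; split => //; exists (f t) => //; apply: near_t => //.
  by rewrite mulr_ge0// divr_ge0// ltW.
have /choice[s sP] : forall j, exists s, 0 <= s <= c /\ thicken F j (f s).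
  move=> j; have [m [k [km Fk]]] := H j; exists (k%:R * (c / (2 ^ m)%:R)); split=> //.
  have p0 : 0 < (2 ^ m)%:R :> R by rewrite ltr0n expn_gt0.
  rewrite mulr_ge0 ?divr_ge0 ?(ltW c0)//=.
  by rewrite mulrCA ger_pMr// ler_pdivrMr// mul1r ler_nat.
have Fs : (s @ \oo) `[0, c]%classic.
  by exists 0%N => // j _; rewrite /= in_itv/=; case: (sP j).
have [t [tc clt]] := @segment_compact R 0 c (s @ \oo) _ Fs.
have /andP[t0 _] : 0 <= t <= c by move: tc; rewrite /= in_itv.
exists t; first by move: tc; rewrite /= in_itv.
apply: cF => V /nbhs_ballP[e /= e0 eV].
have [|r r0 near_t] := path_near cf t0 (e := e / 2); first by rewrite divr_gt0.
have [j0 _ j0e] := near_infty_natSinv_lt (PosNum (divr_gt0 e0 (@ltr0n R 2))).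
have [_ [[j j0j <-] sjt]] := clt (s @` [set j | (j0 <= j)%N]) (ball t r)
  (ltac:(exists j0 => // j ?; exists j => //)) (nbhsx_ballx t _ r0).
have [/andP[sj0 _] [y Fy yj]] := sP j.
exists y; split => //; apply: eV; rewrite -ball_normE /=.
rewrite (splitr e) (le_lt_trans (ler_distD (f (s j)) _ _))// ltrD//.
  by rewrite distrC; apply: near_t => //; rewrite distrC.
by apply: lt_trans yj _; exact: (j0e j).
Qed.

Lemma exit_time_measurable d (T : measurableType d) (X : R -> T -> 'rV[R]_n) A (s : R) :
  (forall t i, 0 <= t -> measurable_fun setT (fun w => X t w 0 i)) ->
  (forall w, {within `[0, +oo[, continuous (X ^~ w)}) ->
  measurable [set w | (s%:E <= exit_time A (X ^~ w))%E].
Proof.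
move=> mX cX; have [s0|s0] := leP s 0.
  suff -> : [set w | (s%:E <= exit_time A (X ^~ w))%E] = setT by [].
  apply/seteqP; split => w //= _; apply/le_exit_time => t /andP[t0 ts].
  by move: (lt_le_trans ts s0); rewrite ltNge t0.
(* The times [c j] increase to [s] and are positive, as [hit_dyadic] requires. *)
pose c (j : nat) : R := s - s / j.+2%:R.
have c0 j : 0 < c j by rewrite subr_gt0 ltr_pdivrMr// ltr_pMr// ltr1n.
have -> : [set w | (s%:E <= exit_time A (X ^~ w))%E] =
  ~` \bigcup_l \bigcap_j \bigcup_m \bigcup_k
   (if (k <= 2 ^ m)%N then
      X (k%:R * (c l / (2 ^ m)%:R)) @^-1` thicken (boundary A) j else set0).
  apply/seteqP; split=> w /=.
    move=> /le_exit_time H [l _ lw]; have cl : c l < s.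
      by rewrite gtrBl divr_gt0// ltr0n.
    have [|t /andP[t0 tc] At] := (hit_dyadic (@boundary_closed A) (c0 l) (cX w)).2.
      move=> j; have [m _ [k _]] := lw j I; case: ifP => // km wV.
      by exists m, k.
    by apply: (H t) => //; rewrite t0 (le_lt_trans tc).
  move=> H; apply/le_exit_time => t /andP[t0 ts] At; apply: H.
  have [l _ ls] := near_infty_natSinv_lt
    (PosNum (divr_gt0 (eq_ind_r is_true ts (subr_gt0 t s)) s0)).
  have {}ls : l.+2%:R^-1 < (s - t) / s by exact: (ls l.+1 (leqnSn l)).
  exists l => // j _.
  have [|m [k [km kV]]] := (hit_dyadic (@boundary_closed A) (c0 l) (cX w)).1 _ j.
    exists t => //; rewrite t0 /c lerBrDr addrC -lerBrDr.
    by rewrite mulrC -ler_pdivlMr// ltW.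
  by exists m => //; exists k => //; rewrite km.
apply: measurableC; apply: bigcupT_measurable => l; apply: bigcapT_measurable => j.
apply: bigcupT_measurable => m; apply: bigcupT_measurable => k; case: ifP => // _.
apply: open_preimage_measurable; last exact: thicken_open.
by move=> i; apply: mX; rewrite mulr_ge0// divr_ge0// ltW.
Qed.

End ExitTime.

(** * Second order Taylor estimate from partial derivatives *)

Section CoordinatewiseMeanValue.
Variables (R : realType) (n : nat).
Implicit Types (f : 'rV[R]_n -> R) (x y z v c : 'rV[R]_n).

Let line_quotient f y v (s : R) :
  (fun h : R => h^-1 *: (((fun u : R => f (y + u *: v)) \o shift s) (h *: 1) -
                         f (y + s *: v))) =
  (fun h : R => h^-1 *: ((f \o shift (y + s *: v)) (h *: v) - f (y + s *: v))).
Proof.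
apply/funext => h /=; congr (_ *: (f _ - _)).
by rewrite scalerDl addrCA [h *: 1]mulr1.
Qed.

Lemma derivable_line f y v (s : R) : derivable f (y + s *: v) v ->
  derivable (fun u : R => f (y + u *: v)) s 1.
Proof. by rewrite /derivable line_quotient. Qed.

Lemma derive_line f y v (s : R) :
  'D_1 (fun u : R => f (y + u *: v)) s = 'D_v f (y + s *: v).
Proof. by rewrite /derive line_quotient. Qed.

Lemma line_increment f y v (k M a b : R) : a <= b ->
  (forall s, a <= s <= b -> derivable f (y + s *: v) v /\
     `|'D_v f (y + s *: v) - k| <= M) ->
  `|f (y + b *: v) - f (y + a *: v) - k * (b - a)| <= M * (b - a).
Proof.
move=> ab H; pose g u := f (y + u *: v).
have gd s : a <= s <= b -> derivable g s 1 by move/H => [/derivable_line].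
have [s /[!in_itv]/= sab||s sab gE] := @MVT_segment R g (fun s => 'D_v f (y + s *: v)) a b ab.
- rewrite -derive_line; apply: derivableP; apply: gd.
  by case/andP: sab => *; rewrite !ltW.
- by apply: derivable_within_continuous => s; rewrite in_itv; exact: gd.
rewrite -/(g b) -/(g a) gE -mulrBl normrM (ger0_norm (_ : 0 <= b - a)) ?subr_ge0//.
by rewrite ler_wpM2r ?subr_ge0//; have [] := H s sab.
Qed.

Let splice x y (k : nat) : 'rV[R]_n := \row_i (if (i < k)%N then y 0 i else x 0 i).

(** Replacing the coordinates of [x] one at a time by those of [y] stays in
    any sup-norm ball around [x] that contains [y], so the one-dimensional
    mean value theorem suffices. *)
Lemma increment_le f x c (r M : R) : 0 <= M ->
  (forall y, `|y - x| <= r -> forall i, derivable f y (delta_mx 0 i) /\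
     `|partial f i y - c 0 i| <= M) ->
  forall y, `|y - x| <= r ->
  `|f y - f x - dot c (y - x)| <= n%:R * M * `|y - x|.
Proof.
move=> M0 H y yx.
have inc (i : 'I_n) : `|f (splice x y i.+1) - f (splice x y i)
    - c 0 i * (y 0 i - x 0 i)| <= M * `|y - x|.
  pose base : 'rV[R]_n := splice x y i - x 0 i *: delta_mx 0 i.
  have seg s : Num.min (x 0 i) (y 0 i) <= s <= Num.max (x 0 i) (y 0 i) ->
      `|(base + s *: delta_mx 0 i) - x| <= r.
    move=> sxy; apply: le_trans yx; apply: norm_le_coord => // j.
    rewrite !mxE eqxx /=; have [->|ji] := eqVneq j i.
      have := coord_le_norm (y - x) i; rewrite !mxE ltnn mulr1.
      apply: le_trans; rewrite mulr1 subrr add0r.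
      have n1 := ler_norm (y 0 i - x 0 i).
      have n2 : x 0 i - y 0 i <= `|y 0 i - x 0 i| by rewrite distrC ler_norm.
      case: (leP (x 0 i) (y 0 i)) sxy => h /andP[h1 h2];
        by rewrite ler_norml; apply/andP; split; lra.
    rewrite !mulr0 subr0 addr0; case: ifP => _.
      by have := coord_le_norm (y - x) j; rewrite !mxE.
    by rewrite subrr normr0.
  have sE : splice x y i = base + x 0 i *: delta_mx 0 i by rewrite subrK.
  have sS : splice x y i.+1 = base + y 0 i *: delta_mx 0 i.
    apply/rowP => j; rewrite !mxE eqxx /=; have [->|ji] := eqVneq j i.
      by rewrite ltnn leqnn !mulr1 subrr add0r.
    by rewrite !mulr0 subr0 addr0 ltnS leq_eqVlt (negbTE (ji : (j != i :> nat))).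
  have xyi : `|y 0 i - x 0 i| <= `|y - x|.
    by have := coord_le_norm (y - x) i; rewrite !mxE.
  apply: le_trans (_ : _ <= M * `|y 0 i - x 0 i|) _; last by rewrite ler_wpM2l.
  rewrite sE sS; case: (leP (x 0 i) (y 0 i)) => [le_xy|/ltW le_yx].
    rewrite [`|y 0 i - x 0 i|]ger0_norm ?subr_ge0//; apply: line_increment => // s sxy.
    by apply: H; apply: seg; rewrite min_l// max_r.
  rewrite (_ : _ - _ - _ = - (f (base + x 0 i *: delta_mx 0 i) -
    f (base + y 0 i *: delta_mx 0 i) - c 0 i * (x 0 i - y 0 i))); last by ring.
  rewrite normrN [`|y 0 i - x 0 i|]distrC (ger0_norm (_ : 0 <= x 0 i - y 0 i)) ?subr_ge0//.
  apply: line_increment => // s sxy.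
  by apply: H; apply: seg; rewrite min_r// max_l.
have s0 : splice x y 0 = x by apply/rowP => i; rewrite mxE.
have sn : splice x y n = y by apply/rowP => i; rewrite mxE ltn_ord.
have -> : f y - f x - dot c (y - x) = \sum_(i < n)
    (f (splice x y i.+1) - f (splice x y i) - c 0 i * (y 0 i - x 0 i)).
  rewrite sumrB; congr (_ - _); last by apply: eq_bigr => i _; rewrite !mxE.
  rewrite -(big_mkord xpredT (fun i => f (splice x y i.+1) - f (splice x y i))).
  by rewrite telescope_sumr// s0 sn.
apply: le_trans (ler_norm_sum _ _ _) _.
rewrite -[X in X%:R]card_ord -sum1_card natr_sum 2!mulr_suml.
by apply: ler_sum => i _; rewrite mul1r; exact: inc.
Qed.

End CoordinatewiseMeanValue.

(** Apply [increment_le] to each partial derivative, whose own partial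
    derivatives are bounded near [x0], and then to [f]. *)
Lemma taylor2 (R : realType) (n : nat) (f : 'rV[R]_n -> R) (x0 : 'rV[R]_n) U :
  open_nbhs x0 U -> smooth_on U f ->
  exists2 r, 0 < r & exists2 K, 0 < K & forall z, `|z| <= r ->
    `|f (x0 + z) - f x0 - dot (grad f x0) z| <= K * `|z| ^+ 2.
Proof.
move=> [oU Ux0] /(_ 3%N) smooth_f.
have dble s i x : (size s < 3)%N -> U x -> derivable (partials s f) x (delta_mx 0 i).
  by move=> s3 Ux; apply: (smooth_f s (ltnW s3) x Ux).2.
pose M : R := 1 + \sum_(i < n) \sum_(j < n) `|partials [:: j; i] f x0|.
have M0 : 0 < M by rewrite ltr_pwDl// sumr_ge0// => i _; rewrite sumr_ge0.
have leM i j : 1 + `|partials [:: j; i] f x0| <= M.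
  have le_sum (F : 'I_n -> R) k : (forall l, 0 <= F l) -> F k <= \sum_l F l.
    by move=> F0; rewrite (bigD1 k)//= lerDl sumr_ge0.
  rewrite /M lerD2l.
  apply: le_trans (le_sum (fun i => \sum_j `|partials [:: j; i] f x0|) i _).
    exact: (le_sum (fun j => `|partials [:: j; i] f x0|)).
  by move=> k; rewrite sumr_ge0.
have bound : \forall x \near x0, forall ij : 'I_n * 'I_n,
    `|partials [:: ij.2; ij.1] f x| <= M.
  apply: (@filter_forall _ _ (fun (ij : 'I_n * 'I_n) x =>
    `|partials [:: ij.2; ij.1] f x| <= M) (nbhs x0) _) => -[i j].
  have := (smooth_f [:: j; i] isT x0 Ux0).1; have := leM i j.
  rewrite [(i, j).1]/= [(i, j).2]/=; move: (partials _ _) => g gM.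
  move=> /cvgrPdist_le/(_ 1 ltr01); apply: filterS => x fx.
  apply: le_trans gM; rewrite -lerBlDr; apply: le_trans fx.
  by rewrite distrC; exact: lerB_dist.
have [r /= r0 Hr] := (nbhs_ballP _ _).1 (filterI (open_nbhs_nbhs (conj oU Ux0)) bound).
have {}Hr x : `|x - x0| <= r / 2 -> U x /\ forall i j, `|partials [:: j; i] f x| <= M.
  move=> xr; have [|? xM] := Hr x; last by split => // i j; exact: (xM (i, j)).
  by rewrite -ball_normE /= distrC; apply: le_lt_trans xr _; rewrite ltr_pdivrMr// ltr_pMr// ltr1n.
exists (r / 2); first by rewrite divr_gt0.
exists (n%:R * (n%:R * M) + 1); first by rewrite ltr_wpDl// !mulr_ge0// ltW.
move=> z zr.
have grad_le i x : `|x - x0| <= `|z| -> `|partial f i x - partial f i x0| <= n%:R * M * `|z|.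
  move=> xz; have := @increment_le _ _ (partial f i) x0 0 (r / 2) M (ltW M0) _ x (le_trans xz zr).
  rewrite /dot (eq_bigr (fun=> 0)) => [|j _]; last by rewrite mxE mul0r.
  rewrite big1// subr0 => H; apply: le_trans (H _) _; last by rewrite ler_wpM2l// mulr_ge0// ltW.
  move=> y /Hr[Uy yM] j; split; first exact: (dble [:: i]).
  by rewrite mxE subr0; exact: yM.
have := @increment_le _ _ f x0 (grad f x0) `|z| (n%:R * M * `|z|).
have Mz : 0 <= n%:R * M * `|z| by rewrite !mulr_ge0// ltW.
move=> /(_ Mz) H; have {}H := H _ (x0 + z); rewrite [_ + z - _]addrAC subrr add0r in H.
apply: le_trans (H _ (lexx _)) _; last first.
  rewrite mulrDl mul1r expr2 !mulrA lerDl.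
  by rewrite mulr_ge0.
move=> y yz i; split; last by rewrite mxE; exact: grad_le.
by apply: (dble [::]) => //; case: (Hr y (le_trans yz zr)).
Qed.

(** * Paths driven into the domain *)

Lemma Rintegral_near_cst (R : realType) (g : R -> R) (k eta T : R) : 0 <= T ->
  {within `[0, +oo[, continuous g} ->
  (forall s, 0 <= s <= T -> `|g s - k| <= eta) ->
  `|\int[lebesgue_measure]_(s in `[0, T]) g s - k * T| <= eta * T.
Proof.
move=> T0 cg gk.
have cgT : {within `[0, T], continuous g}.
  apply: continuous_subspaceW cg => s; rewrite /= !in_itv/= andbT.
  by case/andP.
have mT : measurable (`[0, T] : set R) by exact: measurable_itv.
have ig : lebesgue_measure.-integrable `[0, T] (EFin \o g).
  by apply: continuous_compact_integrable => //; exact: segment_compact.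
have ic (c : R) : lebesgue_measure.-integrable (`[0, T] : set R) (EFin \o cst c).
  apply: continuous_compact_integrable; first exact: segment_compact.
  by apply: continuous_subspaceT => x; exact: cst_continuous.
have cstE (c : R) : \int[lebesgue_measure]_(s in `[0, T]) (cst c s) = c * T.
  rewrite Rintegral_cst//= lebesgue_measure_itv/= lte_fin.
  case: ltP => [T1|T1]; last by congr (_ * _); apply/eqP; rewrite eq_le T0 T1.
  by rewrite /= subr0.
have lo : (k - eta) * T <= \int[lebesgue_measure]_(s in `[0, T]) g s.
  rewrite -cstE; apply: le_Rintegral => // s; rewrite /= in_itv/= => /gk.
  by rewrite ler_norml => /andP[+ _]; lra.
have hi : \int[lebesgue_measure]_(s in `[0, T]) g s <= (k + eta) * T.
  rewrite -cstE; apply: le_Rintegral => // s; rewrite /= in_itv/= => /gk.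
  by rewrite ler_norml => /andP[_ +]; lra.
move: lo hi; rewrite mulrBl mulrDl; move: (Rintegral _ _ _) (k * T) (eta * T) => I a e.
by rewrite ler_norml => lo hi; apply/andP; split; lra.
Qed.

Lemma first_exit (R : realType) (n : nat) (G : set 'rV[R]_n) (f : R -> 'rV[R]_n) (t : R) :
  open G -> {within `[0, +oo[, continuous f} -> 0 <= t -> ~ G (f t) ->
  exists s, [/\ 0 <= s <= t, ~ G (f s) & forall u, 0 <= u < s -> G (f u)].
Proof.
move=> oG cf t0 Gt; pose E := [set s | 0 <= s /\ ~ G (f s)].
have lbE : lbound E 0 by move=> s [].
have infE : has_inf E by split; [exists t|exists 0].
have inf0 : 0 <= inf E by apply: lb_le_inf => //; exists t.
exists (inf E); split.
- by rewrite inf0/=; apply: ge_inf; [exists 0|].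
- move=> Ginf; have [e /= e0 eG] := (nbhs_ballP _ _).1 (open_nbhs_nbhs (conj oG Ginf)).
  have [r r0 near_inf] := path_near cf inf0 e0.
  have [s Es sr] := inf_adherent r0 infE; have [s0 Gs] := Es.
  apply: Gs; apply: eG; rewrite -ball_normE /= distrC; apply: near_inf => //.
  rewrite ger0_norm ?subr_ge0; last by apply: ge_inf => //; exists 0.
  by rewrite ltrBlDl.
- move=> u /andP[u0 uE]; apply: contrapT => Gu.
  by move: uE; rewrite ltNge; apply/negP/negPn; apply: ge_inf; [exists 0|].
Qed.

(** Apply [taylor2] to a defining function and divide by the length of its
    gradient. *)
Lemma interior_paraboloid (R : realType) (n : nat) (A : set 'rV[R]_n) (p nu : 'rV[R]_n) :
  outward_unit_normal A p nu ->
  dot nu nu = 1 /\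
  exists2 r, 0 < r & exists2 K, 0 < K & forall z, `|z| <= r ->
    K * `|z| ^+ 2 < - dot nu z -> A (p + z).
Proof.
move=> [rho [[U pU smooth_rho] rho0 grad0 rhoA] ->].
set g := enorm (grad rho p).
have g0 : 0 < g.
  rewrite lt_def sqrtr_ge0 andbT; apply: contraNneq grad0 => g_eq0.
  apply/eqP/rowP => i; rewrite [RHS]mxE; apply/eqP.
  rewrite -normr_le0 -[leRHS]g_eq0.
  exact: coord_le_enorm.
split.
  by rewrite dotZr dotC dotZr -sqr_enorm -/g; field; rewrite gt_eqF.
have [r r0 [K K0 taylor]] := taylor2 pU smooth_rho.
have [e /= e0 Ae] := (nbhs_ballP _ _).1 rhoA.
exists (Num.min r (e / 2)); first by rewrite lt_min r0 divr_gt0.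
exists (K / g); first by rewrite divr_gt0.
move=> z; rewrite le_min => /andP[zr ze] Kz.
apply: (Ae (p + z) _).2.
  rewrite -ball_normE /= opprD addrA subrr sub0r normrN.
  by apply: le_lt_trans ze _; rewrite ltr_pdivrMr// ltr_pMr// ltr1n.
have := taylor z zr; rewrite rho0 subr0 ler_norml => /andP[_].
move: Kz; rewrite dotC dotZr dotC -(ltr_pM2l g0).
have -> : g * (K / g * `|z| ^+ 2) = K * `|z| ^+ 2 by field; rewrite gt_eqF.
have -> : g * - (g^-1 * dot (grad rho p) z) = - dot (grad rho p) z by field; rewrite gt_eqF.
lra.
Qed.

Lemma open_notin_boundary (R : realType) (n : nat) (A : set 'rV[R]_n) x :
  open A -> A x -> ~ boundary A x.
Proof. by rewrite openE => oA Ax [_]; apply; exact: oA. Qed.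

(** Stop the path when it first meets the boundary or leaves a small ball
    around [x0]. Up to that time the drift stays close to [b x0]. So the height
    is at least [u0 / 2 + beta * t / 4], where [u0] is the initial one, while
    the displacement is too small to leave either the ball or the interior
    paraboloid. Hence the path did neither at the stopping time. *)
Lemma stays_inside (R : realType) (n : nat) (A : set 'rV[R]_n)
    (b : 'rV[R]_n -> 'rV[R]_n) (x0 nu : 'rV[R]_n) :
  open A -> smooth_map b -> outward_unit_normal A x0 nu -> dot (b x0) nu < 0 ->
  exists2 t0, 0 < t0 & exists2 kappa, 0 < kappa & exists2 rho, 0 < rho &
  forall (x : 'rV[R]_n) (f W : R -> 'rV[R]_n),
  A (x0 + x) -> 0 < - dot nu x -> - dot nu x <= rho -> `|x| <= rho ->
  `|x| ^+ 2 <= rho * - dot nu x ->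
  {within `[0, +oo[, continuous f} -> f 0 = x0 + x ->
  (forall t, 0 <= t -> (t%:E <= exit_time A f)%E -> forall i,
    f t 0 i = (x0 + x) 0 i
      + \int[lebesgue_measure]_(s in `[0, t]) (b (f s) 0 i) + W t 0 i) ->
  (forall t, 0 <= t <= t0 ->
    dot nu (W t) <= - dot nu x / 2 + - dot (b x0) nu / 4 * t) ->
  (forall t, 0 <= t <= t0 -> forall i, W t 0 i ^+ 2 <= kappa * (- dot nu x + t)) ->
  (t0%:E <= exit_time A f)%E.
Proof.
move=> oA smooth_b normal; have [nu1 [r r0 [K K0 parabola]]] := interior_paraboloid normal.
set beta := - dot (b x0) nu; rewrite -oppr_gt0 -/beta => beta0.
have nu_le1 i : `|nu 0 i| <= 1.
  by apply: le_trans (coord_le_enorm nu i) _; rewrite /enorm nu1 sqrtr1.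
pose N : R := n%:R + 1; have N0 : 0 < N by rewrite ltr_wpDl.
(* Within [eta] of [b x0] in each coordinate, the drift keeps half of its inward
   speed. *)
pose eta := beta / (2 * N); have eta0 : 0 < eta by rewrite divr_gt0// mulr_gt0.
have b_cont y i : {for y, continuous (fun x => b x 0 i)}.
  by apply: (smooth_b i 0%N [::] (leqnn _) y I).1.
have b_near : \forall y \near x0, forall i, `|b x0 0 i - b y 0 i| <= eta.
  apply: (@filter_forall _ _ (fun i y => `|b x0 0 i - b y 0 i| <= eta) (nbhs x0) _) => i.
  by have /cvgrPdist_le/(_ eta eta0) := b_cont x0 i.
have [r' /= r'0 b_close] := (nbhs_ballP _ _).1 b_near.
pose r1 := Num.min r (r' / 2).
have r1_gt0 : 0 < r1 by rewrite lt_min r0 divr_gt0.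
have r1r : r1 <= r by rewrite ge_min lexx.
have {}b_close y : `|y - x0| <= r1 -> forall i, `|b y 0 i - b x0 0 i| <= eta.
  move=> yr i; rewrite distrC; apply: b_close; rewrite -ball_normE /= distrC.
  apply: le_lt_trans yr _; rewrite gt_min ltr_pdivrMr// ltr_pMr// ltr1n.
  by rewrite orbT.
pose M := `|b x0| + eta; have M0 : 0 < M by rewrite ltr_wpDl.
(* The bounds with [r1] keep the path in the ball of radius [r1], with a quarter
   of [r1] for each of the three parts of the displacement; those with [K] keep
   it in the paraboloid; the bounds by [1] give [u0 + t <= 2]. *)
pose rho := Num.min (r1 / 4) (Num.min 1 (24 * K)^-1).
pose kappa := Num.min (r1 ^+ 2 / 32) (Num.min (24 * K)^-1 (beta / (48 * K))).
pose t0 := Num.min 1 (Num.min (r1 / (4 * M)) (beta / (48 * K * M ^+ 2))).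
have rho0 : 0 < rho by rewrite !lt_min !(divr_gt0, invr_gt0, mulr_gt0, ltr01)//.
have kappa0 : 0 < kappa.
  by rewrite !lt_min !(divr_gt0, invr_gt0, mulr_gt0, exprn_gt0).
have t0_gt0 : 0 < t0.
  by rewrite !lt_min !(divr_gt0, invr_gt0, mulr_gt0, exprn_gt0, ltr01).
exists t0 => //; exists kappa => //; exists rho => //.
move=> x f W Ax; set u0 := - dot nu x => u0_gt0 u0_rho x_rho x2 cf f0 eqn W1 W2.
rewrite leNgt; apply/negP => exit_lt.
have : ~ (t0%:E <= exit_time A f)%E by apply/negP; rewrite -ltNge.
move/le_exit_time/existsNP => [t /not_implyP[/andP[t_ge0 t_lt] /contrapT t_bdry]].
pose G : set 'rV[R]_n := ~` boundary A `&` ball x0 r1.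
have oG : open G.
  apply: openI; first exact/closed_openC/boundary_closed.
  exact: ball_open.
have [|T [/andP[T0 Tt] GT Gbefore]] := @first_exit R n G f t oG cf t_ge0.
  by case.
have Tt0 : T <= t0 by apply: le_trans Tt (ltW t_lt).
have T_exit : (T%:E <= exit_time A f)%E.
  by apply/le_exit_time => s /Gbefore[].
have T_in s : 0 <= s <= T -> `|f s - x0| <= r1.
  have GE u : G (f u) -> `|f u - x0| < r1 by case=> _; rewrite -ball_normE /= distrC.
  move=> /andP[s0]; rewrite le_eqVlt => /predU1P[->|sT]; last first.
    by apply/ltW/GE/Gbefore; rewrite s0.
  have T_gt0 : 0 < T.
    rewrite lt_def T0 andbT; apply: contra_notN GT => /eqP ->.
    split; first by rewrite f0; exact: open_notin_boundary.
    rewrite -ball_normE /= f0 opprD addrA subrr sub0r normrN.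
    apply: le_lt_trans x_rho _; rewrite gt_min ltr_pdivrMr// ltr_pMr//.
    by rewrite ltr1n.
  rewrite leNgt; apply/negP => far.
  have [|e e0 near_T] := path_near cf T0 (e := `|f T - x0| - r1).
    by rewrite subr_gt0.
  pose u := Num.max 0 (T - e / 2).
  have u0' : 0 <= u by rewrite le_max lexx.
  have uT : u < T by rewrite gt_max T_gt0 gtrBl divr_gt0.
  have ue : `|u - T| < e.
    have : T - e / 2 <= u by rewrite le_max lexx orbT.
    by rewrite ltr0_norm ?subr_lt0// => ?; lra.
  have := near_T u u0' ue; have := GE u (Gbefore u (introT andP (conj u0' uT))).
  have := ler_distD (f u) (f T) x0; rewrite [`|f T - f u|]distrC.
  lra.
have T0t0 : 0 <= T <= t0 by rewrite T0.
pose drift : 'rV[R]_n := \row_i \int[lebesgue_measure]_(s in `[0, T]) (b (f s) 0 i).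
have fT : f T - x0 = x + drift + W T.
  by apply/rowP => i; rewrite !mxE (eqn T T0 T_exit i) !mxE; ring.
have drift_near i : `|drift 0 i - b x0 0 i * T| <= eta * T.
  rewrite mxE; apply: Rintegral_near_cst => //; last by move=> s /T_in/b_close.
  apply/subspace_continuousP => s s0; have /subspace_continuousP := cf.
  by move=> /(_ s s0) fs; exact: (cvg_comp _ _ fs (b_cont (f s) i)).
have drift_le : `|drift| <= M * T.
  apply: norm_le_coord => [|i]; first by rewrite mulr_ge0// ltW.
  rewrite -[drift 0 i](subrK (b x0 0 i * T)); apply: le_trans (ler_normD _ _) _.
  rewrite addrC /M mulrDl lerD// normrM (ger0_norm T0) ler_wpM2r//.
  exact: coord_le_norm.
have dot_drift : dot nu drift <= - (beta / 2) * T.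
  have dn : `|drift - T *: b x0| <= eta * T.
    apply: norm_le_coord => [|i]; first by rewrite mulr_ge0// ltW.
    by have := drift_near i; rewrite !mxE [T * _]mulrC.
  rewrite -(subrK (T *: b x0) drift) dotDr dotZr [dot nu (b x0)]dotC.
  have -> : dot (b x0) nu = - beta by rewrite opprK.
  have : dot nu (drift - T *: b x0) <= beta / 2 * T.
    rewrite dotC; apply: le_trans (ler_norm _) _.
    apply: le_trans (dot_norm_le _ nu_le1) _.
    apply: le_trans (_ : n%:R * (eta * T) <= _); first by rewrite ler_wpM2l.
    rewrite mulrA ler_wpM2r// /eta mulrA ler_pdivrMr ?mulr_gt0//.
    have -> : beta / 2 * (2 * N) = beta * N by field.
    by rewrite mulrC ler_wpM2l ?(ltW beta0)// lerDl.
  lra.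
have W_le : `|W T| ^+ 2 <= kappa * (u0 + T).
  have c0 : 0 <= kappa * (u0 + T) by rewrite mulr_ge0// ?addr_ge0// ltW.
  rewrite -[leRHS]sqr_sqrtr// ler_sqr ?nnegrE ?sqrtr_ge0//.
  apply: norm_le_coord => [|i]; first exact: sqrtr_ge0.
  by rewrite -sqrtr_sqr ler_sqrt//; exact: W2.
set z := f T - x0 in fT.
have height : u0 / 2 + beta / 4 * T <= - dot nu z.
  by rewrite fT !dotDr; have := W1 T T0t0; rewrite -/u0 -/beta /u0; lra.
have K_neq0 : K != 0 by rewrite gt_eqF.
have M_neq0 : M != 0 by rewrite gt_eqF.
have Krho : K * rho <= 1 / 24.
  rewrite (_ : 1 / 24 = K * (24 * K)^-1); last by field.
  by rewrite ler_wpM2l ?(ltW K0)// !ge_min lexx !orbT.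
have Kkappa : K * kappa <= 1 / 24.
  rewrite (_ : 1 / 24 = K * (24 * K)^-1); last by field.
  by rewrite ler_wpM2l ?(ltW K0)// !ge_min lexx !orbT.
have Kkappa' : K * kappa <= beta / 48.
  rewrite (_ : beta / 48 = K * (beta / (48 * K))); last by field.
  by rewrite ler_wpM2l ?(ltW K0)// !ge_min lexx !orbT.
have KMt0 : K * M ^+ 2 * t0 <= beta / 48.
  rewrite (_ : beta / 48 = K * M ^+ 2 * (beta / (48 * K * M ^+ 2))); last first.
    by field; rewrite K_neq0 M_neq0.
  by rewrite ler_wpM2l ?mulr_ge0 ?exprn_ge0 ?(ltW K0) ?(ltW M0)// !ge_min lexx !orbT.
have Mt0 : M * t0 <= r1 / 4.
  rewrite (_ : r1 / 4 = M * (r1 / (4 * M))); last by field.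
  by rewrite ler_wpM2l ?(ltW M0)// !ge_min lexx !orbT.
have rho1 : rho <= 1 by rewrite !ge_min lexx !orbT.
have rho4 : rho <= r1 / 4 by rewrite ge_min lexx.
have t0_le1 : t0 <= 1 by rewrite ge_min lexx.
have kappa_r1 : kappa <= r1 ^+ 2 / 32 by rewrite ge_min lexx.
have zn : `|z| <= `|x| + M * T + `|W T|.
  rewrite fT; apply: le_trans (ler_normD _ _) _; rewrite lerD2r.
  by apply: le_trans (ler_normD _ _) _; rewrite lerD2l.
have MT0 : 0 <= M * T by rewrite mulr_ge0// ltW.
have z_small : `|z| < r1.
  have MT4 : M * T <= r1 / 4 by apply: le_trans Mt0; rewrite ler_wpM2l// ltW.
  have W4 : `|W T| <= r1 / 4.
    rewrite -ler_sqr ?nnegrE//; last by rewrite divr_ge0// ltW.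
    apply: le_trans W_le _; apply: le_trans (_ : r1 ^+ 2 / 32 * 2 <= _); last first.
      by rewrite expr_div_n; lra.
    by apply: ler_pM => //; [exact: ltW|rewrite addr_ge0// ltW|lra].
  lra.
have Kz : K * `|z| ^+ 2 < - dot nu z.
  apply: lt_le_trans height; apply: le_lt_trans (_ : _ <= u0 / 4 + beta / 8 * T) _; last first.
    by have : 0 <= beta * T by [rewrite mulr_ge0// ltW]; lra.
  have z2 : `|z| ^+ 2 <= 3 * (`|x| ^+ 2 + (M * T) ^+ 2 + `|W T| ^+ 2).
    apply: le_trans (_ : (`|x| + M * T + `|W T|) ^+ 2 <= _).
      by rewrite ler_sqr ?nnegrE ?addr_ge0.
    rewrite -subr_ge0 (_ : _ - _ = (`|x| - M * T) ^+ 2 + (`|x| - `|W T|) ^+ 2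
      + (M * T - `|W T|) ^+ 2); last by ring.
    by rewrite !addr_ge0// sqr_ge0.
  have MT2 : (M * T) ^+ 2 <= M ^+ 2 * t0 * T.
    by rewrite exprMn expr2 -!mulrA !ler_wpM2l// ?(ltW M0)// expr2 ler_wpM2r.
  apply: le_trans (_ : K * (3 * (rho * u0 + M ^+ 2 * t0 * T + kappa * (u0 + T))) <= _).
    by rewrite ler_wpM2l ?(ltW K0)//; apply: le_trans z2 _; rewrite ler_wpM2l// !lerD.
  have -> : K * (3 * (rho * u0 + M ^+ 2 * t0 * T + kappa * (u0 + T))) =
    3 * (K * rho + K * kappa) * u0 + 3 * (K * M ^+ 2 * t0 + K * kappa) * T by ring.
  apply: lerD; last by rewrite ler_wpM2r//; lra.
  by rewrite [leRHS]mulrC ler_wpM2r ?(ltW u0_gt0)//; lra.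
apply: GT; split; last by rewrite -ball_normE /= distrC.
apply: open_notin_boundary => //; have -> : f T = x0 + z by rewrite addrC subrK.
by apply: parabola => //; apply: le_trans r1r; exact: ltW.
Qed.

(** * Asymptotics and exponential moments *)

(** Split the exponential into [M.+1] equal factors and bound each of them by
    [e^(- 1 / y) <= y]. *)
Lemma expR_rpole_le (R : realType) (c eps : R) (M : nat) : 0 < c -> 0 < eps ->
  \forall h \near 0^'+, expR (- (c / h)) <= eps * h ^+ M.
Proof.
move=> c0 eps0; pose k : R := (M.+1)%:R / c.
have k0 : 0 < k by rewrite divr_gt0.
near=> h.
have h0 : 0 < h by near: h; exact: nbhs_right_gt.
have hk : h <= eps / k ^+ M.+1.
  by apply/ltW; near: h; apply: nbhs_right_lt; rewrite divr_gt0// exprn_gt0.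
have kh0 : 0 < k * h by rewrite mulr_gt0.
have -> : - (c / h) = - (k * h)^-1 *+ M.+1.
  by rewrite mulNrn -mulr_natr /k; congr (- _); field; rewrite !gt_eqF.
rewrite -mulr_natr expRM_natr.
have : expR (- (k * h)^-1) <= k * h.
  rewrite expRN -[leRHS]invrK lef_pV2 ?posrE ?expR_gt0 ?invr_gt0//.
  by apply: le_trans (expR_ge1Dx _); rewrite lerDr.
move=> /(@lerXn2r _ M.+1) H; apply: le_trans (H _ _) _; rewrite ?nnegrE ?expR_ge0 ?(ltW kh0)//.
rewrite exprMn [h ^+ M.+1]exprS mulrA ler_wpM2r ?exprn_ge0 ?(ltW h0)//.
by rewrite mulrC -ler_pdivlMr// exprn_gt0.
Unshelve. all: by end_near. Qed.

Lemma expRN_le (R : realType) (y : R) : 0 <= y <= 1 -> expR (- y) <= 1 - y / 2.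
Proof.
move=> /andP[y0 y1]; have y1' : 0 < 1 + y by rewrite ltr_pwDl.
rewrite expRN; apply: le_trans (_ : (1 + y)^-1 <= _).
  by rewrite lef_pV2 ?posrE ?expR_gt0// expR_ge1Dx.
rewrite -(ler_pM2l y1') divff ?gt_eqF// -subr_ge0.
have -> : (1 + y) * (1 - y / 2) - 1 = y * (1 - y) / 2 by field.
by rewrite divr_ge0// mulr_ge0// subr_ge0.
Qed.

Section ExponentialMoment.
Variables (R : realType) (d : measure_display) (T : measurableType d).
Variables (P : probability T R) (tau : T -> \bar R).
Hypothesis mtau : forall s : R, measurable [set w | (s%:E <= tau w)%E].

Lemma exponential_moment_ge (c s : R) : 0 < c ->
  ((expR (c * s))%:E * P [set w | (s%:E <= tau w)%E]
   <= \int[P]_w expeR (c%:E * tau w))%E.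
Proof.
move=> c0; set S := [set w | _]; have mS : measurable S by exact: mtau.
have mf : measurable_fun setT (fun w => expeR (c%:E * tau w)).
  apply: (measurability _ (ErealGenCInfty.measurableE R)) => // _ [_ [r ->] <-].
  rewrite setTI; have [r0|r0] := leP r 0.
    rewrite (_ : _ @^-1` _ = setT)//; apply/seteqP; split=> // w _ /=.
    by rewrite in_itv/= andbT (le_trans _ (expeR_ge0 _))// lee_fin.
  rewrite (_ : _ @^-1` _ = [set w | ((ln r / c)%:E <= tau w)%E])//.
  apply/seteqP; split=> w /=; rewrite in_itv/= andbT.
    rewrite -[r in r%:E]lnK// -[(expR _)%:E]/(expeR (ln r)%:E) lee_expeR.
    by rewrite -lee_pdivrMl// -EFinM mulrC.
  move=> H; rewrite -[r in r%:E]lnK// -[(expR _)%:E]/(expeR (ln r)%:E) lee_expeR.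
  by rewrite -lee_pdivrMl// -EFinM mulrC.
have -> : ((expR (c * s))%:E * P S = \int[P]_w (expR (c * s) * \1_S w)%:E)%E.
  under eq_integral do rewrite EFinM.
  rewrite ge0_integralZl//= ?integral_indic ?setIT ?lee_fin ?expR_ge0//.
  by apply/measurable_EFinP; exact: measurable_indic.
apply: ge0_le_integral => //.
- by apply/measurable_EFinP; apply: measurable_funM => //; exact: measurable_indic.
- move=> w _; rewrite indicE; case: (boolP (w \in S)) => wS; last first.
    by rewrite mulr0 expeR_ge0.
  rewrite mulr1 -[(expR _)%:E]/(expeR (c * s)%:E) lee_expeR EFinM.
  by apply: lee_wpmul2l; [rewrite lee_fin ltW|move: wS; rewrite inE].
Qed.

End ExponentialMoment.

(** * Brownian motion crossing a parabola *)

Section ParabolaCrossing.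
Variables (R : realType) (d : measure_display) (T : measurableType d).
Variables (P : probability T R).

Lemma union_bound (J : Type) (r : seq J) (N : J -> set T) (e : R) :
  (forall j, measurable (N j)) -> (forall j, (P (N j) <= e%:E)%E) ->
  measurable (\big[setU/set0]_(j <- r) N j) /\
  (P (\big[setU/set0]_(j <- r) N j) <= ((size r)%:R * e)%:E)%E.
Proof.
move=> mN PN; elim: r => [|j r [mr Pr]]; first by rewrite big_nil measure0 mul0r.
rewrite big_cons; split; first exact: measurableU.
apply: le_trans (measureU2 _ (mN j) mr) _.
by rewrite /= -natr1 mulrDl mul1r addrC EFinD leeD.
Qed.

Variables (dim : nat) (B : R -> T -> 'rV[R]_dim).
Hypothesis bmB : brownian_motion P B.

(** Cut time into steps of length [u]. During step [k] the square root of
    [a * (u + t)] is at least its initial value [l k], and the line of height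
    [l k / 2] at time [0] and [l k] at the end of the step is at most [l k]. The
    product of this height and the slope is [a / 4] for every [k]. *)
Lemma parabola_crossing (a u H : R) : 0 < a -> 0 < u -> 0 < H ->
  exists2 N : set T, measurable N /\
    (P N <= (2 * dim%:R * (H / u + 1) * expR (- (a / 2)))%:E)%E &
    forall w, ~ N w -> forall t, 0 <= t <= H -> forall i,
      B t w 0 i ^+ 2 <= a * (u + t).
Proof.
move=> a0 u0 H0; pose m := (Num.trunc (H / u)).+1.
pose sgn (s : bool) : R := if s then -1 else 1.
pose l (k : nat) := Num.sqrt (a * (k.+1%:R * u)).
have au k : 0 < a * (k.+1%:R * u) by rewrite !mulr_gt0.
have l0 k : 0 < l k by rewrite sqrtr_gt0.
have line (j : 'I_dim * bool * 'I_m) : exists N : set T,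
    [/\ measurable N, (P N <= (expR (- (a / 2)))%:E)%E &
    forall w, ~ N w -> forall t, 0 <= t <= H ->
      sgn j.1.2 * B t w 0 j.1.1 <= l j.2 / 2 + l j.2 / (2 * (j.2.+1%:R * u)) * t].
  have unit_e : dot (sgn j.1.2 *: delta_mx 0 j.1.1) (sgn j.1.2 *: delta_mx 0 j.1.1) = 1 :> R.
    rewrite dotZr dotC dotZr dot_delta mxE !eqxx mulr1 /sgn.
    by case: j.1.2; ring.
  have q0 : 0 < l j.2 / (2 * (j.2.+1%:R * u)) by rewrite divr_gt0// !mulr_gt0.
  have [N [mN PN] HN] := line_crossing bmB (l j.2 / 2) unit_e q0 H0.
  exists N; split=> //; last first.
    by move=> w /HN wN t /wN; rewrite dotC dotZr dotC dot_delta.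
  apply: le_trans PN _; rewrite lee_fin ler_expR lerN2 le_eqVlt; apply/orP; left.
  apply/eqP; transitivity (l j.2 ^+ 2 / (2 * (j.2.+1%:R * u))); last first.
    by field; rewrite !gt_eqF ?mulr_gt0.
  rewrite sqr_sqrtr ?ltW//; field.
  by rewrite !gt_eqF// ltr0n.
have [N HN] := choice line.
have [mN PN] : measurable (\big[setU/set0]_(j <- enum {: 'I_dim * bool * 'I_m}) N j) /\
  (P (\big[setU/set0]_(j <- enum {: 'I_dim * bool * 'I_m}) N j) <=
    ((size (enum {: 'I_dim * bool * 'I_m}))%:R * expR (- (a / 2)))%:E)%E.
  by apply: union_bound => j; have [] := HN j.
exists (\big[setU/set0]_(j <- enum {: 'I_dim * bool * 'I_m}) N j).
  split=> //; apply: le_trans PN _; rewrite lee_fin ler_wpM2r ?expR_ge0//.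
  rewrite -cardE !card_prod card_bool !card_ord !natrM [dim%:R * 2]mulrC ler_wpM2l ?mulr_ge0//.
  by rewrite /m -natr1 lerD2r truncn_le// divr_ge0// ltW.
move=> w Nw t /[dup] tH /andP[t0 tH'] i.
have tu0 : 0 <= t / u by rewrite divr_ge0// ltW.
have /andP[klo khi] := truncn_itv tu0; set k := Num.trunc (t / u) in klo khi.
have km : (k < m)%N.
  by rewrite ltnS le_truncn// ler_wpM2r// invr_ge0 ltW.
have kt : t <= k.+1%:R * u by rewrite -ler_pdivrMr// ltW.
have side (s : bool) : sgn s * B t w 0 i <= l k.
  have Ns : ~ N (i, s, Ordinal km) w.
    move=> Nsw; apply: Nw; rewrite -bigcup_seq; exists (i, s, Ordinal km) => //=.
    by rewrite mem_enum.
  have [_ _ /(_ w Ns t tH)/=] := HN (i, s, Ordinal km).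
  move=> /le_trans; apply; rewrite [leRHS](splitr (l k)) lerD2l.
  rewrite -[leRHS]mulr1 invfM mulrA -[leLHS]mulrA ler_wpM2l ?divr_ge0 ?(ltW (l0 k))//.
  by rewrite mulrC ler_pdivrMr ?mul1r// mulr_gt0.
have lE : l k ^+ 2 = a * (k.+1%:R * u) by rewrite sqr_sqrtr// ltW.
apply: le_trans (_ : l k ^+ 2 <= _).
  rewrite -real_normK ?num_real// ler_sqr ?nnegrE ?(ltW (l0 k))//.
  have := side true; have := side false; rewrite /sgn mul1r mulN1r => h1 h2.
  by rewrite ler_norml h1 andbT lerNl.
rewrite lE ler_wpM2l ?(ltW a0)// -natr1 mulrDl mul1r addrC lerD2l.
by rewrite -ler_pdivlMr.
Qed.

End ParabolaCrossing.

(** * Survival for a fixed time *)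

(** Off three exceptional sets [stays_inside] applies. Their measures add up to
    at most [1] minus a multiple of [h ^+ N]: the line stays uncrossed with
    probability at least [c3 * h ^+ N / 2], and half of this absorbs the
    exponentially small probability of crossing the parabola. *)
Lemma survival_probability (R : realType) (n : nat) (A : set 'rV[R]_n)
    (b : 'rV[R]_n -> 'rV[R]_n) (x0 nu : 'rV[R]_n) (h0 : R)
    (d : measure_display) (T : measurableType d) (P : probability T R)
    (B : R -> T -> 'rV[R]_n) (X : R -> 'rV[R]_n -> R -> T -> 'rV[R]_n) :
  open A -> smooth_map b -> outward_unit_normal A x0 nu -> dot (b x0) nu < 0 ->
  0 < h0 -> brownian_motion P B ->
  (forall h y, 0 < h < h0 -> A y -> sde_until_exit P A b h B y (X h y)) ->
  exists2 t0, 0 < t0 &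
  forall (mu : R) (N : nat) (x : R -> 'rV[R]_n) (c1 c2 : R),
  0 < mu -> 0 < c1 -> 0 < c2 ->
  (forall h, 0 < h < h0 ->
     [/\ c1 * h ^+ N < enorm (x h) < h,
         dot ((enorm (x h))^-1 *: x h) nu < - c2 & A (x0 + x h)]) ->
  \forall h \near 0^'+, ((expR (- (mu / h)))%:E <=
    P [set w | (t0%:E <= exit_time A (fun t => X h (x0 + x h)%R t w))%E])%E.
Proof.
move=> oA smooth_b normal inward h0_gt0 bmB sde.
have [t0 t0_gt0 [kappa kappa0 [rho rho0 inside]]] := stays_inside oA smooth_b normal inward.
exists t0 => // mu N x c1 c2 mu0 c1_gt0 c2_gt0 xP.
have [nu1 _] := interior_paraboloid normal.
have nu_le1 i : `|nu 0 i| <= 1.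
  by apply: le_trans (coord_le_enorm nu i) _; rewrite /enorm nu1 sqrtr1.
set beta := - dot (b x0) nu; have beta0 : 0 < beta by rewrite oppr_gt0.
pose c3 := Num.min (c1 * c2 * beta / 8) 1.
have c3_gt0 : 0 < c3 by rewrite lt_min ltr01 divr_gt0// !mulr_gt0.
pose C4 := 2 * n%:R * (t0 / (c1 * c2) + 1) + 1.
have C4_gt0 : 0 < C4.
  by rewrite ltr_wpDl// !mulr_ge0// addr_ge0// divr_ge0 ?mulr_ge0 ?ltW.
near=> h.
have h_gt0 : 0 < h by near: h; exact: nbhs_right_gt.
have hh0 : 0 < h < h0 by rewrite h_gt0; near: h; exact: nbhs_right_lt.
have h1 : h <= 1 by apply/ltW; near: h; exact: nbhs_right_lt.
have h_rho : h <= rho by apply/ltW; near: h; exact: nbhs_right_lt.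
have h_rho2 : h <= rho / (n%:R + 1).
  by apply/ltW; near: h; apply: nbhs_right_lt; rewrite divr_gt0// ltr_wpDl.
have h_c2 : h <= rho * c2 by apply/ltW; near: h; apply: nbhs_right_lt; rewrite mulr_gt0.
have decay : expR (- (kappa / 4 / h)) <= c3 / (4 * C4) * h ^+ (N + N).
  by near: h; apply: expR_rpole_le; rewrite divr_gt0// mulr_gt0.
have decay_mu : expR (- (mu / h)) <= c3 / 4 * h ^+ N.
  by near: h; apply: expR_rpole_le => //; rewrite divr_gt0.
have [/andP[xlo xhi] xnu Ax] := xP h hh0.
have hN0 : 0 < h ^+ N by rewrite exprn_gt0.
have hN1 : h ^+ N <= 1 by rewrite exprn_ile1// ltW.
set y := x h in xlo xhi xnu Ax *.
have e0 : 0 < enorm y by apply: lt_trans xlo; rewrite mulr_gt0.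
pose u0 := - dot nu y.
have u0_c2 : c2 * enorm y < u0.
  by move: xnu; rewrite dotC dotZr mulrC ltr_pdivrMr// mulNr ltrNr.
have u0_hN : c1 * c2 * h ^+ N < u0.
  by apply: lt_trans u0_c2; rewrite mulrAC mulrC ltr_pM2l.
have u0_gt0 : 0 < u0 by apply: lt_trans u0_c2; rewrite mulr_gt0.
have y_h : `|y| <= h by apply: le_trans (norm_le_enorm y) (ltW xhi).
have s0 : 0 < Num.sqrt (2 * h) by rewrite sqrtr_gt0 mulr_gt0.
have s2 : Num.sqrt (2 * h) ^+ 2 = 2 * h by rewrite sqr_sqrtr// mulr_ge0// ltW.
have q0 : 0 < beta / 4 / Num.sqrt (2 * h) by rewrite !divr_gt0.
have [N1 [mN1 PN1] HN1] := line_crossing bmB (u0 / 2 / Num.sqrt (2 * h)) nu1 q0 t0_gt0.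
have a0 : 0 < kappa / (2 * h) by rewrite divr_gt0// mulr_gt0.
have [N2 [mN2 PN2] HN2] := parabola_crossing bmB a0 u0_gt0 t0_gt0.
have sdeX := sde h _ hh0 Ax.
have [N3 [mN3 PN3 sN3]] := sde_equation sdeX.
set S := [set w | _].
have mS : measurable S.
  by apply: exit_time_measurable; [exact: sde_measurable sdeX|exact: sde_continuous sdeX].
have subS : ~` S `<=` N1 `|` (N2 `|` N3).
  move=> w Sw; apply: contrapT => Nw; apply: Sw.
  apply: (inside y _ (fun t => Num.sqrt (2 * h) *: B t w)) => //.
  - rewrite -/u0; apply: le_trans (ler_norm _) _; rewrite normrN dotC.
    apply: le_trans (dot_norm_le _ nu_le1) _.
    apply: le_trans (_ : (n%:R + 1) * h <= _); last by rewrite mulrC -ler_pdivlMr// ltr_wpDl.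
    by rewrite ler_pM// lerDl.
  - exact: le_trans y_h h_rho.
  - rewrite -/u0 expr2; apply: le_trans (_ : (rho * c2) * enorm y <= _); last first.
      by rewrite -mulrA ler_wpM2l// ltW.
    by apply: ler_pM => //; [exact: le_trans y_h h_c2|exact: norm_le_enorm].
  - exact: sde_continuous sdeX w.
  - exact: sde_start sdeX w.
  - move=> t t_ge0 t_exit i; rewrite [(_ *: B t w) 0 i]mxE.
    have eqw : forall t : R, 0 <= t -> (t%:E <= exit_time A (fun t => X h (x0 + y)%R t w))%E ->
        forall i, X h (x0 + y) t w 0 i = (x0 + y) 0 i
          + \int[lebesgue_measure]_(s in `[0, t]%classic) (b (X h (x0 + y) s w) 0 i)
          + Num.sqrt (2 * h) * B t w 0 i.
      by apply: contrapT => H; apply: Nw; right; right; exact: sN3.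
    exact: eqw.
  - move=> t tt0; rewrite dotZr -/u0 -/beta.
    have /HN1/(_ t tt0) : ~ N1 w by move=> ?; apply: Nw; left.
    rewrite -(ler_pM2l s0) => /le_trans; apply; rewrite le_eqVlt; apply/orP; left.
    by apply/eqP; field; rewrite gt_eqF.
  - move=> t tt0 i; rewrite mxE -/u0 exprMn s2.
    have /HN2/(_ t tt0 i) : ~ N2 w by move=> ?; apply: Nw; right; left.
    rewrite -(ler_pM2l (_ : 0 < 2 * h)) ?mulr_gt0// => /le_trans; apply.
    rewrite le_eqVlt; apply/orP; left.
    by apply/eqP; field; rewrite gt_eqF.
have PN1' : (P N1 <= (1 - c3 * h ^+ N / 2)%:E)%E.
  apply: le_trans PN1 _; rewrite lee_fin; apply: le_trans (expRN_le _); last first.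
    rewrite mulr_ge0 ?(ltW c3_gt0) ?(ltW hN0)//=.
    by rewrite -[leRHS]mul1r ler_pM ?(ltW c3_gt0) ?(ltW hN0)// ge_min lexx orbT.
  rewrite ler_expR lerN2.
  have -> : 2 * (u0 / 2 / Num.sqrt (2 * h)) * (beta / 4 / Num.sqrt (2 * h)) = u0 * beta / 8 / h.
    transitivity (u0 * beta / 4 / Num.sqrt (2 * h) ^+ 2); first by field; rewrite gt_eqF.
    by rewrite s2; field; rewrite gt_eqF.
  rewrite ler_pdivlMr//; apply: le_trans (_ : c3 * h ^+ N <= _).
    by rewrite -[leRHS]mulr1 ler_wpM2l// mulr_ge0// ltW.
  apply: le_trans (_ : c1 * c2 * beta / 8 * h ^+ N <= _).
    by rewrite ler_wpM2r ?(ltW hN0)// ge_min lexx.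
  have -> : c1 * c2 * beta / 8 * h ^+ N = (c1 * c2 * h ^+ N) * (beta / 8) by field.
  by rewrite -[leRHS]mulrA ler_wpM2r ?(ltW u0_hN)// divr_ge0// ltW.
have PN2' : (P N2 <= (c3 * h ^+ N / 4)%:E)%E.
  apply: le_trans PN2 _; rewrite lee_fin.
  have -> : kappa / (2 * h) / 2 = kappa / 4 / h by field; rewrite gt_eqF.
  apply: le_trans (_ : C4 / h ^+ N * (c3 / (4 * C4) * h ^+ (N + N)) <= _); last first.
    by rewrite exprD le_eqVlt; apply/orP; left; apply/eqP; field; rewrite !gt_eqF.
  apply: ler_pM => //; rewrite ?expR_ge0//.
    by rewrite mulr_ge0 ?mulr_ge0// addr_ge0// divr_ge0 ?ltW.
  have steps : (t0 / u0 + 1) * h ^+ N <= t0 / (c1 * c2) + 1.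
    rewrite mulrDl mul1r lerD// mulrAC ler_pdivrMr// -[leRHS]mulrA ler_wpM2l ?(ltW t0_gt0)//.
    by rewrite mulrC ler_pdivlMr ?mulr_gt0// mulrC ltW.
  rewrite ler_pdivlMr// -[X in X <= _]mulrA.
  apply: le_trans (_ : 2 * n%:R * (t0 / (c1 * c2) + 1) <= _); last by rewrite lerDl.
  by rewrite ler_wpM2l// mulr_ge0.
have bad : (P (~` S) <= (1 - c3 / 4 * h ^+ N)%:E)%E.
  apply: le_trans (_ : P (N1 `|` (N2 `|` N3)) <= _)%E.
    by apply: le_measure subS; rewrite inE; [exact: measurableC|do !apply: measurableU].
  apply: le_trans (measureU2 _ _ _) _ => //; first exact: measurableU.
  have P23 : (P (N2 `|` N3) <= (c3 * h ^+ N / 4)%:E)%E.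
    apply: (le_trans (measureU2 P mN2 mN3)); rewrite -[leRHS]adde0.
    by apply: leeD => //; rewrite le_eqVlt; apply/orP; left; apply/eqP.
  apply: le_trans (leeD PN1' P23) _; rewrite -EFinD lee_fin; lra.
have PSfin : P S \is a fin_num by exact: fin_num_measure.
move: bad; rewrite probability_setC// -(fineK PSfin) -EFinB !lee_fin => bad.
apply: le_trans decay_mu _; lra.
Unshelve. all: by end_near. Qed.

(** * The exit time from a point near the boundary *)

Theorem proposition10p1 (R : realType) :
  (* c_alpha depends on alpha only *)
  exists2 c_ : R -> R, (forall alpha, 1 < alpha -> 0 < c_ alpha) &
  forall (d : nat) (Omega : set 'rV[R]_d) (b nu : 'rV[R]_d -> 'rV[R]_d)
    (x0 : 'rV[R]_d) (h0 lambda : R) (lambda1 : R -> R)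
    (disp : measure_display) (T : measurableType disp) (P : probability T R)
    (B : R -> T -> 'rV[R]_d)
    (X : R -> 'rV[R]_d -> R -> T -> 'rV[R]_d),
  (0 < d)%N ->
  bounded_domain Omega -> smooth_boundary Omega ->
  smooth_map b ->
  (forall p, boundary Omega p -> outward_unit_normal Omega p (nu p)) ->
  boundary Omega x0 -> dot (b x0) (nu x0) < 0 ->
  0 < h0 ->
  (* X h y is the process started at y, driven by the Brownian motion B *)
  brownian_motion P B ->
  (forall h y, 0 < h < h0 -> Omega y ->
     sde_until_exit P Omega b h B y (X h y)) ->
  (forall h, 0 < h < h0 -> principal_eigenvalue h b Omega (lambda1 h)) ->
  ((2 <= d)%N -> forall h, 0 < h < h0 ->
     0 < lambda < lambda1 h /\ lambda != dot (b x0) (nu x0) ^+ 2 / 4) ->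
  (d = 1%N -> forall h, 0 < h < h0 ->
     0 < lambda < Num.min (lambda1 h) (dot (b x0) (nu x0) ^+ 2 / 4)) ->
  exists2 gamma : R, 0 < gamma &
  forall (N : nat) (x : R -> 'rV[R]_d) (c1 c2 : R),
  (1 <= N)%N -> 0 < c1 -> 0 < c2 ->
  (forall h, 0 < h < h0 ->
     [/\ c1 * h ^+ N < enorm (x h) < gamma * h,
         dot ((enorm (x h))^-1 *: x h) (nu x0) < - c2 &
         Omega (x0 + x h)]) ->
  let tau (h : R) (w : T) : \bar R :=
    exit_time Omega (fun t => X h (x0 + x h) t w) in
  let hlogE (h : R) : \bar R :=
    (h%:E * lne (\int[P]_w expeR ((lambda / h)%:E * tau h w)))%E in
  (exists2 C : R, 0 < C &
     \forall h \near 0^'+, ((C * h * ln h^-1)%:E <= hlogE h)%E) /\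
  (analytic_boundary_near Omega x0 -> analytic_map_near b x0 ->
   exists2 delta : R, 0 < delta &
     (\forall h \near 0^'+, (delta%:E <= hlogE h)%E) /\
     forall alpha eps : R, 1 < alpha -> 0 < eps ->
     exists2 s : R -> R,
       (forall h, 0 < h < h0 -> delta - h `^ (1 - eps) < s h) &
       \forall h \near 0^'+,
         ((Num.min (c_ alpha * expR (- (alpha * (s h - delta) / h))) 1)%:E
            <= P [set w | (s h / lambda)%:E <= tau h w])%E /\
         (P [set w | (s h / lambda)%:E <= tau h w]
            <= P [set w | ((delta - h `^ (1 - eps)) / lambda)%:E
                            <= tau h w])%E).
Proof.
exists (fun=> 1) => // d Omega b nu x0 h0 lambda lambda1 disp T P B X.
move=> d0 [oOmega _ _ _] _ smooth_b normal x0_bdry inward h0_gt0 bmB sde _.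
move=> lambda_ge2 lambda_eq1.
have lambda0 : 0 < lambda.
  have half : 0 < h0 / 2 < h0 by rewrite divr_gt0//= ltr_pdivrMr// ltr_pMr// ltr1n.
  move: d0; rewrite leq_eqVlt => /predU1P[d1|/lambda_ge2 /(_ _ half)[/andP[]]//].
  by have /andP[] := lambda_eq1 (esym d1) _ half.
have [t0 t0_gt0 survive] := survival_probability oOmega smooth_b
  (normal x0 x0_bdry) inward h0_gt0 bmB sde.
exists 1 => // N x c1 c2 _ c1_gt0 c2_gt0 xP tau hlogE.
(* Half of [lambda * t0] pays for the small probability of surviving. *)
pose delta := lambda * t0 / 2.
have delta0 : 0 < delta by rewrite divr_gt0// mulr_gt0.
have surv : \forall h \near 0^'+, ((expR (- (delta / h)))%:E <=
    P [set w | t0%:E <= tau h w])%E.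
  apply: (survive delta N x c1 c2 delta0 c1_gt0 c2_gt0) => h /xP[].
  by rewrite mul1r.
have lambda_t0 : lambda * t0 = delta + delta by rewrite /delta; field.
have mtau h s : 0 < h < h0 -> measurable [set w | (s%:E <= tau h w)%E].
  move=> hh0; have [_ _ Ox] := xP h hh0; have sdeX := sde h _ hh0 Ox.
  by apply: exit_time_measurable; [exact: sde_measurable sdeX|exact: sde_continuous sdeX].
have growth : \forall h \near 0^'+, (delta%:E <= hlogE h)%E.
  near=> h.
  have h_gt0 : 0 < h by near: h; exact: nbhs_right_gt.
  have hh0 : 0 < h < h0 by rewrite h_gt0; near: h; exact: nbhs_right_lt.
  have lh0 : 0 < lambda / h by rewrite divr_gt0.
  have moment : ((expR (delta / h))%:E <=
      \int[P]_w expeR ((lambda / h)%:E * tau h w))%E.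
    apply: le_trans (exponential_moment_ge P (fun s => mtau h s hh0) t0 lh0).
    have -> : delta / h = lambda / h * t0 + - (delta / h).
      by rewrite /delta; field; rewrite gt_eqF.
    rewrite expRD EFinM; apply: lee_wpmul2l; first by rewrite lee_fin expR_ge0.
    by near: h.
  rewrite /hlogE -[delta](divfK (lt0r_neq0 h_gt0)) mulrC EFinM.
  apply: lee_wpmul2l; first by rewrite lee_fin ltW.
  rewrite -[(delta / h)%:E]expeRK lee_lne// in_itv/= leey andbT.
    by rewrite lee_fin expR_ge0.
  by apply: integral_ge0 => w _; exact: expeR_ge0.
split.
  exists delta => //; near=> h.
  have h_gt0 : 0 < h by near: h; exact: nbhs_right_gt.
  apply: le_trans (_ : delta%:E <= _)%E; last by near: h.
  rewrite lee_fin -mulrA -[leRHS]mulr1 ler_wpM2l ?(ltW delta0)//.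
  rewrite mulrC -ler_pdivlMr// div1r.
  have hV0 : 0 < h^-1 by rewrite invr_gt0.
  have := @le_ln1Dx _ (h^-1 - 1); rewrite [1 + _]addrC subrK => ln_le.
  apply: le_trans (ln_le _) _; last by rewrite gerBl.
  by rewrite ltrBrDr addNr.
move=> _ _; exists delta => //; split=> // alpha eps alpha1 eps0.
exists (fun=> lambda * t0) => [h _|].
  apply: le_lt_trans (_ : delta < _); last by rewrite lambda_t0 ltrDl.
  by rewrite gerBl powR_ge0.
near=> h.
have h_gt0 : 0 < h by near: h; exact: nbhs_right_gt.
have hh0 : 0 < h < h0 by rewrite h_gt0; near: h; exact: nbhs_right_lt.
have -> : lambda * t0 / lambda = t0 by field; rewrite gt_eqF.
split.
  apply: le_trans (_ : (expR (- (delta / h)))%:E <= _)%E; last by near: h.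
  rewrite lee_fin mul1r ge_min; apply/orP; left.
  rewrite ler_expR lerN2 lambda_t0 addrK ler_wpM2r ?invr_ge0 ?(ltW h_gt0)//.
  by rewrite ler_peMl// ltW.
apply: le_measure; rewrite ?inE; [exact: mtau|exact: mtau|].
move=> w; apply: le_trans; rewrite lee_fin ler_pdivrMr//.
rewrite [t0 * _]mulrC lambda_t0.
apply: le_trans (_ : delta <= _); last by rewrite lerDl ltW.
by rewrite gerBl powR_ge0.
Unshelve. all: by end_near. Qed.
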